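(* For every fixed integer $K\ge1$, there is an FPTAS for the $K$-parametric knapsack problem: for every $\varepsilon\in(0,1)$ and every instance (as defined in the context) with $n$ items, where $n$ is assumed to be much larger than $\frac1\varepsilon$, a $(1+\varepsilon)$-approximation set can be computed in time $$\mathcal{O}\left(\left(n\log\frac1\varepsilon+\frac1{\varepsilon^3}\log^2\frac1\varepsilon\right)\left(\frac1\varepsilon\log\frac1\varepsilon+\frac1\varepsilon\log(nC)\right)^K\right),$$ where $C$ denotes the maximum profit component among all $a_e,b_{k,e}$.
   Context: Instance: items $E=\{1,\dots,n\}$, a budget $W\in\mathbb{N}_0$, and for each item $e$ a weight $w_e\in\mathbb{N}_0$ and nonnegative integers $a_e,b_{1,e},\dots,b_{K,e}$ defining the parametric profit $a_e+\sum_{k=1}^K\lambda_kb_{k,e}$. For each $k$ some $b_{k,e}$ is nonzero. Let $\lambda^{\min}_k=\max_{e\in E}\left\{-\frac{a_e}{K\,b_{k,e}}:b_{k,e}\ne0\right\}$ and $\Lambda=\prod_{k=1}^K[\lambda^{\min}_k,\infty)$. Feasible solutions are the subsets $x\subseteq E$ with $\sum_{e\in x}w_e\le W$, and the profit at $\lambda\in\Lambda$, to be maximized, is $f(x,\lambda)=\sum_{e\in x}\left(a_e+\sum_{k=1}^K\lambda_kb_{k,e}\right)$. A $\beta$-approximation set ($\beta\ge1$) is a finite set $S$ of feasible solutions such that for every $\lambda\in\Lambda$ there is $x\in S$ with $f(x,\lambda)\ge\frac1\beta f(x',\lambda)$ for all feasible $x'$. An FPTAS is a family of algorithms computing, for each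 $\varepsilon>0$, a $(1+\varepsilon)$-approximation set in time polynomial in the instance size and $1/\varepsilon$. Known result that may be used: for the non-parametric knapsack problem there is an algorithm that, for any $\varepsilon'>0$, computes a feasible solution with profit at least $(1-\varepsilon')$ times the profit of any other feasible solution in time $\mathcal{O}\left(n\min\{\log n,\log\frac1{\varepsilon'}\}+\frac1{\varepsilon'}\log\frac1{\varepsilon'}\cdot\min\{n,\frac1{\varepsilon'}\log\frac1{\varepsilon'}\}\right)$ (Kellerer and Pferschy, as quoted in the source). Conventions: $\log$ is base 2; $K$ is constant, the $\mathcal{O}$-constant may depend on $K$ only, and the bound is understood asymptotically for small $\varepsilon$. *)

(* Defs.v *)
From mathcomp Require Import all_boot all_order all_algebra.
From mathcomp Require Import reals exp.

Set Implicit Arguments.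
Unset Strict Implicit.
Unset Printing Implicit Defensive.

Import Order.TTheory GRing.Theory Num.Theory.

(** * Model of computation

    Running times are measured on a word RAM, programmed in a small structured
    language.  The memory consists of arrays of machine words; a program names
    finitely many arrays and computes the indices into them, so scalars are
    single cells.  Arithmetic on words and memory access have unit cost.  All
    words are required to stay below a bound [B]: a program that would produce
    a larger number has no execution.  Without such a bound, unit-cost
    multiplication would make "polynomial time" meaningless. *)

Inductive binop := OpAdd | OpSub | OpMul | OpDiv | OpLt | OpEq.

(** [OpSub] truncates at 0, [OpDiv] is Euclidean division (with [x / 0 = 0]),
    comparisons return 0 or 1. *)
Definition binop_sem (o : binop) : nat -> nat -> nat :=
  match o with
  | OpAdd => addn
  | OpSub => subn
  | OpMul => muln
  | OpDiv => divn
  | OpLt => fun x y => nat_of_bool (x < y)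
  | OpEq => fun x y => nat_of_bool (x == y)
  end.

Inductive expr :=
  | Const (c : nat)
  | Read (a : nat) (i : expr)
  | Bin (o : binop) (e1 e2 : expr).

(** [Call P a b] runs [P], in a fresh memory, on the sequence held in array [a]
    and stores the sequence it returns in array [b]. *)
Inductive cmd :=
  | Skip
  | Write (a : nat) (i e : expr)
  | Seq (c1 c2 : cmd)
  | If (e : expr) (c1 c2 : cmd)
  | While (e : expr) (c : cmd)
  | Call (P : cmd) (a b : nat).

Definition memory := nat -> nat -> nat.

Definition set_array (m : memory) (a : nat) (f : nat -> nat) : memory :=
  fun a' => if a' == a then f else m a'.

Definition set_cell (m : memory) (a i v : nat) : memory :=
  set_array m a (fun i' => if i' == i then v else m a i').

(** A sequence is held in an array as its length followed by its elements;
    [put_seq] leaves the remaining cells unchanged. *)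
Definition put_seq (s : seq nat) (f : nat -> nat) : nat -> nat :=
  fun i => nth (f i) (size s :: s) i.

Definition get_seq (f : nat -> nat) : seq nat :=
  mkseq (fun i => f i.+1) (f 0).

(** Programs receive their input in array 0 and return their output in array 1. *)
Definition init_memory (input : seq nat) : memory :=
  set_array (fun _ _ => 0) 0 (put_seq input (fun _ => 0)).

Definition output_of (m : memory) : seq nat := get_seq (m 1).

Fixpoint eval (m : memory) (e : expr) : nat :=
  match e with
  | Const c => c
  | Read a i => m a (eval m i)
  | Bin o e1 e2 => binop_sem o (eval m e1) (eval m e2)
  end.

(** Every number occurring in the evaluation of [e] is smaller than [B]. *)
Fixpoint fits (B : nat) (m : memory) (e : expr) : bool :=
  (eval m e < B) &&
  match e with
  | Const _ => true
  | Read _ i => fits B m i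
  | Bin _ e1 e2 => fits B m e1 && fits B m e2
  end.

Fixpoint expr_cost (e : expr) : nat :=
  match e with
  | Const _ => 1
  | Read _ i => (expr_cost i).+1
  | Bin _ e1 e2 => (expr_cost e1 + expr_cost e2).+1
  end.

(** [exec B c m t m']: started in memory [m], the command [c] terminates in
    memory [m'] after [t] steps.  A call is charged for the steps of the callee
    and for copying its argument and its result. *)
Inductive exec (B : nat) : cmd -> memory -> nat -> memory -> Prop :=
  | exec_skip m : exec B Skip m 1 m
  | exec_write a i e m of fits B m i & fits B m e :
      exec B (Write a i e) m (expr_cost i + expr_cost e).+1
        (set_cell m a (eval m i) (eval m e))
  | exec_seq c1 c2 m t1 m1 t2 m2 of exec B c1 m t1 m1 & exec B c2 m1 t2 m2 :
      exec B (Seq c1 c2) m (t1 + t2).+1 m2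
  | exec_if_true e c1 c2 m t m' of fits B m e & eval m e <> 0
        & exec B c1 m t m' :
      exec B (If e c1 c2) m (expr_cost e + t).+1 m'
  | exec_if_false e c1 c2 m t m' of fits B m e & eval m e = 0
        & exec B c2 m t m' :
      exec B (If e c1 c2) m (expr_cost e + t).+1 m'
  | exec_while_stop e c m of fits B m e & eval m e = 0 :
      exec B (While e c) m (expr_cost e).+1 m
  | exec_while_step e c m t1 m1 t2 m2 of fits B m e & eval m e <> 0
        & exec B c m t1 m1 & exec B (While e c) m1 t2 m2 :
      exec B (While e c) m (expr_cost e + t1 + t2).+1 m2
  | exec_call P a b m t m' of exec B P (init_memory (get_seq (m a))) t m' :
      exec B (Call P a b) m
        (size (get_seq (m a)) + t + size (output_of m')).+1
        (set_array m b (put_seq (output_of m') (m b))).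

Definition runs (B : nat) (P : cmd) (input : seq nat) (t : nat)
    (output : seq nat) : Prop :=
  exists2 m, exec B P (init_memory input) t m & output = output_of m.

(** The smallest word bound a program with parameter [d] may rely on: words
    have [d * log2 M] bits, where [M] bounds the length and the entries of the
    input. *)
Definition word_bound (d : nat) (input : seq nat) : nat :=
  (2 + size input + \max_(v <- input) v) ^ d.

(** The instance size: total binary length of a sequence of numbers. *)
Definition bit_size (s : seq nat) : nat :=
  \sum_(v <- s) (trunc_log 2 v).+1.

(** * Knapsack *)

Definition feasible (n : nat) (W : nat) (w : 'I_n -> nat) (x : {set 'I_n}) :
    bool :=
  \sum_(e in x) w e <= W.

(** Common encoding of the data: number of items, budget, weights, and then one
    row of profits (knapsack) or [K + 1] rows (parametric knapsack). *)
Definition encode (n : nat) (W : nat) (w : 'I_n -> nat)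
    (rows : seq ('I_n -> nat)) : seq nat :=
  [:: n, W & flatten [seq codom r | r <- w :: rows]].

Definition encode_solution (n : nat) (x : {set 'I_n}) : seq nat :=
  codom (fun e : 'I_n => nat_of_bool (e \in x)).

(** The profit of item [e] at [lambda] is
    [base e + \sum_k lambda k * slope k e]. *)
Record pknapsack (K n : nat) := PKnapsack {
  budget : nat;
  weight : 'I_n -> nat;
  base : 'I_n -> nat;
  slope : 'I_K -> 'I_n -> nat;
  slope_neq0 : forall k : 'I_K, exists e : 'I_n, slope k e != 0
}.

Definition pk_encode (K n : nat) (I : pknapsack K n) : seq nat :=
  encode (budget I) (weight I) (base I :: [seq slope I k | k <- enum 'I_K]).

Definition pk_feasible (K n : nat) (I : pknapsack K n) (x : {set 'I_n}) : bool :=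
  feasible (budget I) (weight I) x.

Definition max_component (K n : nat) (I : pknapsack K n) : nat :=
  maxn (\max_e base I e) (\max_k \max_e slope I k e).

Local Open Scope ring_scope.

Definition log2 (R : realType) (x : R) : R := ln x / ln 2.

Section ParametricKnapsack.
Variables (R : realType) (K n : nat) (I : pknapsack K n).

Definition breakpoint (k : 'I_K) (e : 'I_n) : R :=
  - ((base I e)%:R / (K%:R * (slope I k e)%:R)).

(** The default value of the maximum is itself one of the values it ranges over. *)
Definition lambda_min (k : 'I_K) : R :=
  \big[Num.max/breakpoint k (xchoose (slope_neq0 I k))]_(e | slope I k e != 0%N)
    breakpoint k e.

Definition param_set (lambda : 'I_K -> R) : Prop :=
  forall k, lambda_min k <= lambda k.

Definition pk_profit (x : {set 'I_n}) (lambda : 'I_K -> R) : R :=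
  \sum_(e in x) ((base I e)%:R + \sum_k lambda k * (slope I k e)%:R).

Definition approximation_set (beta : R) (S : seq {set 'I_n}) : Prop :=
  (forall x, x \in S -> pk_feasible I x) /\
  (forall lambda, param_set lambda ->
     exists2 x, x \in S &
       forall x', pk_feasible I x' ->
         beta^-1 * pk_profit x' lambda <= pk_profit x lambda).

End ParametricKnapsack.

(** An accuracy is passed to a program as two words [p] and [q].  Since a real
    [eps] need not be rational, [p / q] may be any lower approximation of it up
    to a factor of 2, in particular [eps] itself if [eps] is rational. *)
Definition accuracy_code (R : realType) (eps : R) (p q : nat) : Prop :=
  [/\ (0 < p)%N, (0 < q)%N & eps / 2 <= p%:R / q%:R <= eps].

(** On the instance [I], the program [P] computes a [(1 + eps)]-approximation
    set in time at most [T], for words of at least [d * log2 M] bits. *)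
Definition computes_within (R : realType) (K : nat) (P : cmd) (d n : nat)
    (I : pknapsack K n) (eps T : R) : Prop :=
  forall p q B : nat, accuracy_code eps p q ->
    (word_bound d [:: p, q & pk_encode I] <= B)%N ->
    exists (t : nat) (S : seq {set 'I_n}),
      [/\ runs B P [:: p, q & pk_encode I] t
            (flatten [seq encode_solution x | x <- S]),
          approximation_set I (1 + eps) S
        & t%:R <= T].

(** [P] is an FPTAS for [K]-parametric knapsack. *)
Definition fptas (R : realType) (K : nat) (P : cmd) : Prop :=
  exists (d g : nat) (c : R),
    forall (n : nat) (I : pknapsack K n) (eps : R), 0 < eps ->
      computes_within P d I eps
        (c * ((bit_size (pk_encode I))%:R + eps^-1) ^+ g).

Definition pk_time (R : realType) (K n : nat) (I : pknapsack K n) (eps : R) : R :=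
  let l := log2 eps^-1 in
  (n%:R * l + eps^-1 ^+ 3 * l ^+ 2) *
  (eps^-1 * l + eps^-1 * log2 (n * max_component I)%:R) ^+ K.

(** * The result of Kellerer and Pferschy on non-parametric knapsack *)

(** The second summand has the factor [eps^-1 ^+ 2] of the published bound.  With
    a single factor [eps^-1], as the bound is sometimes quoted, [kellerer_pferschy]
    would be a stronger assumption. *)
Definition kp_time (R : realType) (n : nat) (eps : R) : R :=
  let l := log2 eps^-1 in
  n%:R * Num.min (log2 n%:R) l +
  eps^-1 ^+ 2 * l * Num.min n%:R (eps^-1 * l).

(** The time bound is asymptotic for small accuracies, since [log2 eps^-1]
    vanishes at 1. *)
Definition kellerer_pferschy (R : realType) : Prop :=
  exists (P : cmd) (d : nat) (c eps0 : R), 0 < eps0 < 1 /\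
    forall (n W : nat) (w profit : 'I_n -> nat) (p q B : nat),
      let eps : R := p%:R / q%:R in
      let input := [:: p, q & encode W w [:: profit]] in
      (0 < n)%N -> (0 < p)%N -> (0 < q)%N -> (word_bound d input <= B)%N ->
      exists (t : nat) (x : {set 'I_n}),
        [/\ runs B P input t (encode_solution x),
            feasible W w x,
            (forall x', feasible W w x' ->
               (1 - eps) * (\sum_(e in x') profit e)%:R
                 <= (\sum_(e in x) profit e)%:R)
          & eps <= eps0 -> t%:R <= c * kp_time n eps].

(* Main.v *)
(* Measuring [lambda] from the corner of the parameter set and clearing denominators
   turns the profit into a linear form with nonnegative weights in [K + 1]
   nonnegative integer components of the solution, one weight being fixed.  If the
   weights split into heavy and light ones with a large gap in between, widening the
   gap changes hardly anything: a light component matters only if all heavy ones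
   vanish, since the components are integers.  Gaps can therefore be narrowed until
   all weights lie in [H^-K, H^K], with [H] polynomial in [n C / eps].  On this cube
   a geometric grid with ratio [1 + O(eps)] has [O(1/eps log H)] points per
   dimension, and the knapsack algorithm of Kellerer and Pferschy with accuracy
   proportional to [eps] is called at each of its points. *)
Require Import Defs.
From mathcomp Require Import all_boot all_order all_algebra.
From mathcomp Require Import reals exp.
From mathcomp Require Import zify ring lra.

Set Implicit Arguments.
Unset Strict Implicit.
Unset Printing Implicit Defensive.

Import Order.TTheory GRing.Theory Num.Theory.

(* The parameter set is unbounded and weights vanish at its corner, so no finite geometric grid
   covers all weight vectors. Narrowing gaps replaces a vector by one in the cube whose good
   solutions remain good for the original. The fixed weight never leaves the window, so at most K
   weights have to be brought in, one for each widening of the window by a factor H on both sides;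
   hence the exponent K and at most K losses of a factor 1 + 1/h.

   The machine knows only bounded natural numbers. Therefore eps enters through E = floor(q/p) + 1,
   where 1/E is at most eps. Weights are multiplied by Z = N H^K with N = 8 E, so that the cube
   becomes the range from N to N H^(2K), in which an integer grid that advances by v / N rounded
   down never stalls. With y = 1/(8 E), the gaps with h = 8 K E cost a factor of at most 1/(1 - y),
   the grid 1 + y, and the knapsack calls keep at least 1 - y; altogether the loss is below 1 + 8 y
   = 1 + 1/E. All stored numbers are bounded by a fixed power of the length and the entries of the
   input, which yields the word bound. *)
Declare Scope expr_scope.
Delimit Scope expr_scope with E.
Bind Scope expr_scope with expr.
Notation "e1 + e2" := (Bin OpAdd e1 e2) : expr_scope.
Notation "e1 - e2" := (Bin OpSub e1 e2) : expr_scope.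
Notation "e1 * e2" := (Bin OpMul e1 e2) : expr_scope.
Notation "e1 / e2" := (Bin OpDiv e1 e2) : expr_scope.
Notation "e1 < e2" := (Bin OpLt e1 e2) : expr_scope.
Notation "e1 == e2" := (Bin OpEq e1 e2) : expr_scope.

(** * Building blocks for expressions and loops, with syntactic degree and cost *)

Definition cell0 (a : nat) : expr := Read a (Const 0).

Fixpoint esum (f : nat -> expr) (n : nat) : expr :=
  if n is n'.+1 then (esum f n' + f n')%E else Const 0.

Fixpoint eprod (f : nat -> expr) (n : nat) : expr :=
  if n is n'.+1 then (eprod f n' * f n')%E else Const 1.

Lemma eval_bin m o e1 e2 :
  eval m (Bin o e1 e2) = binop_sem o (eval m e1) (eval m e2).
Proof. by []. Qed.

Lemma eval_read m a e : eval m (Read a e) = m a (eval m e).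
Proof. by []. Qed.

Lemma eval_cell0 m a : eval m (cell0 a) = m a 0.
Proof. by []. Qed.

Lemma eval_esum m f n : eval m (esum f n) = \sum_(k < n) eval m (f k).
Proof. by elim: n => [|n IHn] /=; rewrite ?big_ord0 // big_ord_recr /= IHn. Qed.

Lemma eval_eprod m f n : eval m (eprod f n) = \prod_(k < n) eval m (f k).
Proof. by elim: n => [|n IHn] /=; rewrite ?big_ord0 // big_ord_recr /= IHn. Qed.

Lemma eval_epow m e n : eval m (eprod (fun=> e) n) = eval m e ^ n.
Proof. by rewrite eval_eprod prod_nat_const card_ord. Qed.

Definition For (s : nat) (hi : expr) (c : cmd) : cmd :=
  Seq (Write s (Const 0) (Const 0))
    (While (cell0 s < hi)%E
      (Seq c (Write s (Const 0) (cell0 s + Const 1)%E))).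

(* If all cells are below [Y], then every number occurring in the evaluation of
   [e] is below [Y ^ edeg e]. *)
Fixpoint edeg (e : expr) : nat :=
  match e with
  | Const c => c.+1
  | Read _ i => (edeg i).+1
  | Bin _ e1 e2 => edeg e1 + edeg e2
  end.

(** A call counts 0 because the numbers inside the callee are governed by its own word bound, not by
    the cells of the caller. *)
Fixpoint cdeg (c : cmd) : nat :=
  match c with
  | Skip => 0
  | Write _ i e => maxn (edeg i) (edeg e)
  | Seq c1 c2 => maxn (cdeg c1) (cdeg c2)
  | If e c1 c2 => maxn (edeg e) (maxn (cdeg c1) (cdeg c2))
  | While e c => maxn (edeg e) (cdeg c)
  | Call _ _ _ => 0
  end.

(* The time of one pass through [c], when each loop body is executed once and
   calls are free. *)
Fixpoint ccost (c : cmd) : nat :=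
  match c with
  | Skip => 1
  | Write _ i e => (expr_cost i + expr_cost e).+1
  | Seq c1 c2 => (ccost c1 + ccost c2).+1
  | If e c1 c2 => (expr_cost e + (ccost c1 + ccost c2)).+1
  | While e c => (expr_cost e + ccost c).+1
  | Call _ _ _ => 1
  end.

Lemma ccost_for s hi c :
  ccost c + ccost (For s hi Skip) = (ccost (For s hi c)).+1.
Proof. by rewrite /=; lia. Qed.

Lemma cdeg_seq c1 c2 d : cdeg (Seq c1 c2) <= d -> cdeg c1 <= d /\ cdeg c2 <= d.
Proof. by cbn [cdeg]; rewrite geq_max => /andP. Qed.

Lemma cdeg_if e c1 c2 d :
  cdeg (If e c1 c2) <= d -> [/\ edeg e <= d, cdeg c1 <= d & cdeg c2 <= d].
Proof. by cbn [cdeg]; rewrite !geq_max => /and3P. Qed.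

Lemma cdeg_while e c d : cdeg (While e c) <= d -> edeg e <= d /\ cdeg c <= d.
Proof. by cbn [cdeg]; rewrite geq_max => /andP. Qed.

Lemma cdeg_for s hi c d : cdeg (For s hi c) <= d -> cdeg c <= d.
Proof. by move=> /cdeg_seq[_]; cbn [cdeg]; rewrite !geq_max => /and3P[]. Qed.

Lemma edeg_gt0 e : 0 < edeg e.
Proof. by elim: e => //= o e1 h1 e2 h2; rewrite addn_gt0 h1. Qed.

(** * A program logic with time and word bounds *)

Definition same (L : seq nat) (m m' : memory) : Prop :=
  forall a, a \notin L -> m' a = m a.

Lemma same_cell L m m' a i v :
  a \in L -> same L m m' -> same L m (set_cell m' a i v).
Proof.
move=> aL h b bL; rewrite /set_cell /set_array.
by case: eqP => [E|_]; [rewrite E aL in bL|exact: h].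
Qed.

Lemma cell_ne m a i v b : b != a -> set_cell m a i v b = m b.
Proof. by rewrite /set_cell /set_array => /negbTE ->. Qed.

Lemma cell_eq m a i v j :
  set_cell m a i v a j = if j == i then v else m a j.
Proof. by rewrite /set_cell /set_array eqxx. Qed.

Section Logic.
Variables B Y D : nat.
Hypotheses (Y_gt1 : 1 < Y) (YDB : Y ^ D <= B).

Definition bounded (m : memory) : Prop := forall a i, m a i < Y.

(** Degrees may be added even for sums, since b1 + b2 <= b1 * b2 for factors of at least 2. This is
    why [edeg] is positive on every expression, including the constant 0. *)
Lemma eval_edeg m e : bounded m -> eval m e < Y ^ edeg e.
Proof.
move=> hm; elim: e => [c|a i IHi|o e1 IH1 e2 IH2] /=.
- exact: leq_trans (ltn_expl c Y_gt1) (leq_pexp2l (ltnW Y_gt1) (leqnSn c)).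
- by apply: leq_trans (hm _ _) _; rewrite expnS leq_pmulr // expn_gt0 ltnW.
have p1 : 1 < Y ^ edeg e1 by rewrite -{1}(expn0 Y) ltn_exp2l // edeg_gt0.
have p2 : 1 < Y ^ edeg e2 by rewrite -{1}(expn0 Y) ltn_exp2l // edeg_gt0.
rewrite expnD; move: (Y ^ edeg e1) (Y ^ edeg e2) p1 p2 IH1 IH2 => b1 b2 p1 p2.
move: (eval m e1) (eval m e2) => x y hx hy.
have xb : x < b1 * b2 by apply: (leq_trans hx); rewrite leq_pmulr // ltnW.
have b12 : 1 < b1 * b2 by apply: (leq_trans p1); rewrite leq_pmulr // ltnW.
case: o => /=.
- by nia.
- exact: leq_ltn_trans (leq_subr _ _) xb.
- exact: ltn_mul.
- exact: leq_ltn_trans (leq_div _ _) xb.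
- exact: leq_ltn_trans (leq_b1 _) b12.
- exact: leq_ltn_trans (leq_b1 _) b12.
Qed.

Lemma fits_edeg m e : bounded m -> edeg e <= D -> fits B m e.
Proof.
move=> hm; have hB e' : edeg e' <= D -> eval m e' < B.
  move=> he; apply: leq_trans (eval_edeg e' hm) (leq_trans _ YDB).
  by rewrite leq_pexp2l // ltnW.
elim: e => [c|a i IHi|o e1 IH1 e2 IH2] hD; rewrite /= (hB _ hD) //=.
- by apply: IHi; apply: leq_trans hD => /=.
- by rewrite IH1 ?IH2 //; apply: leq_trans hD; rewrite /= ?leq_addr ?leq_addl.
Qed.

Lemma bounded_cell m a i v : bounded m -> v < Y -> bounded (set_cell m a i v).
Proof.
by move=> hm hv b j; rewrite /set_cell /set_array; do 2?case: eqP => // _.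
Qed.

(** Total correctness with a time bound. Having the postcondition as a predicate lets [run_seq] put
    the run of the second command there, so proofs follow the order of the program. *)
Definition run (c : cmd) (m : memory) (T : nat) (Q : memory -> Prop) : Prop :=
  exists t m', [/\ exec B c m t m', t <= T & Q m'].

Lemma run_weaken c m T T' (Q Q' : memory -> Prop) :
  T <= T' -> (forall m', Q m' -> Q' m') -> run c m T Q -> run c m T' Q'.
Proof.
by move=> hT hQ [t [m' [h1 h2 h3]]]; exists t, m'; split; [|exact: leq_trans hT|exact: hQ].
Qed.

Lemma run_seq c1 c2 m T1 T2 Q :
  run c1 m T1 (fun m1 => run c2 m1 T2 Q) -> run (Seq c1 c2) m (T1 + T2).+1 Q.
Proof.
move=> [t1 [m1 [h1 ht1 [t2 [m2 [h2 ht2 hQ]]]]]].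
exists (t1 + t2).+1, m2; split=> //; first exact: exec_seq h1 h2.
by rewrite ltnS leq_add.
Qed.

Lemma run_write a i e m (Q : memory -> Prop) :
  bounded m -> cdeg (Write a i e) <= D ->
  Q (set_cell m a (eval m i) (eval m e)) ->
  run (Write a i e) m (ccost (Write a i e)) Q.
Proof.
move=> hm /=; rewrite geq_max => /andP[hi he] hQ.
by do 2!eexists; split; [apply: exec_write; exact: fits_edeg| |exact: hQ].
Qed.

Lemma run_if e c1 c2 m T Q :
  bounded m -> edeg e <= D ->
  (eval m e != 0 -> run c1 m T Q) -> (eval m e = 0 -> run c2 m T Q) ->
  run (If e c1 c2) m (expr_cost e + T).+1 Q.
Proof.
move=> hm he h1 h2; have hf := fits_edeg hm he.
have [h0|h0] := eqVneq (eval m e) 0.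
  have [t [m' [hx ht hQ]]] := h2 h0; exists (expr_cost e + t).+1, m'.
  by split=> //; [exact: exec_if_false|rewrite ltnS leq_add2l].
have [t [m' [hx ht hQ]]] := h1 h0; exists (expr_cost e + t).+1, m'.
by split=> //; [exact: exec_if_true hf (elimN eqP h0) hx|rewrite ltnS leq_add2l].
Qed.

Lemma run_while e c (N T : nat) (J : nat -> memory -> Prop) m :
  (forall j m, J j m -> bounded m) -> edeg e <= D ->
  (forall j m, j < N -> J j m -> eval m e != 0 /\ run c m T (J j.+1)) ->
  (forall m, J N m -> eval m e = 0) ->
  J 0 m ->
  run (While e c) m (N * (expr_cost e + T).+1 + (expr_cost e).+1) (J N).
Proof.
move=> hb he hs hN h0.
suff gen : forall k j m, j + k = N -> J j m ->
    run (While e c) m (k * (expr_cost e + T).+1 + (expr_cost e).+1) (J N).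
  exact: (gen N 0).
elim=> [|k IHk] j {h0}m hj hJ.
  rewrite addn0 in hj; rewrite hj in hJ; exists (expr_cost e).+1, m; split=> //.
  by apply: exec_while_stop; [apply: fits_edeg he; exact: hb hJ|exact: hN].
have [hn [t1 [m1 [h1 ht1 hQ1]]]] : eval m e != 0 /\ run c m T (J j.+1).
  by apply: hs hJ; rewrite -hj -addSnnS leq_addr.
have [|t2 [m2 [h2 ht2 hQ2]]] := IHk j.+1 m1 _ hQ1; first by rewrite addSnnS.
exists (expr_cost e + t1 + t2).+1, m2; split=> //; last by rewrite mulSn; lia.
by apply: exec_while_step h1 h2; [apply: fits_edeg he; exact: hb hJ|exact/eqP].
Qed.

(** The loop bound is evaluated anew in each round, hence the hypothesis that the invariant fixes
    its value; the invariant must not see the counter, which the loop itself overwrites. *)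
Lemma run_for s hi c (N T : nat) (J : nat -> memory -> Prop) m :
  bounded m -> N < Y -> cdeg (For s hi c) <= D ->
  (forall j m v, J j m -> J j (set_cell m s 0 v)) ->
  (forall j m, J j m -> eval m hi = N) ->
  (forall j m, j < N -> J j m -> bounded m -> m s 0 = j ->
     run c m T (fun m' => [/\ J j.+1 m', bounded m' & m' s 0 = j])) ->
  J 0 m ->
  run (For s hi c) m (N.+1 * (T + ccost (For s hi Skip)))
    (fun m' => J N m' /\ bounded m').
Proof.
move=> hm hNY hD hJs hhi hstep h0.
have Y0 : 0 < Y by apply: ltnW.
have [hD0 hDe hDc hDs] : [/\ cdeg (Write s (Const 0) (Const 0)) <= D,
    edeg (cell0 s < hi)%E <= D, cdeg c <= D &
    cdeg (Write s (Const 0) (cell0 s + Const 1)%E) <= D].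
  move: hD; rewrite /For; cbn [cdeg]; rewrite !geq_max.
  by case/andP=> a1 /andP[b1 /andP[b2 /andP[b3 b4]]]; rewrite b3 b4.
pose J' j m := [/\ J j m, bounded m & m s 0 = j].
apply: (@run_weaken _ _ _ _ (J' N)) (leqnn _) _ _; first by move=> ? [].
apply: (@run_weaken _ _ (ccost (Write s (Const 0) (Const 0)) +
  (N * (expr_cost (cell0 s < hi)%E + (T +
     ccost (Write s (Const 0) (cell0 s + Const 1)%E)).+1).+1 +
     (expr_cost (cell0 s < hi)%E).+1)).+1 _ (J' N)) => //.
  rewrite /= ; nia.
apply: run_seq; apply: run_write => //=.
apply: run_while => //.
- by move=> j m' [].
- move=> j m' hj [hJ hb hs]; split; first by rewrite /= hs (hhi _ _ hJ) hj.
  apply: run_seq; apply: run_weaken (leqnn _) _ (hstep _ _ hj hJ hb hs).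
  move=> m1 [hJ1 hb1 hs1]; apply: run_write => //=; rewrite hs1 addn1.
  split; [exact: hJs|apply: bounded_cell => //|by rewrite cell_eq].
  exact: leq_ltn_trans hNY.
- by move=> m' [hJ _ hs]; rewrite /= hs (hhi _ _ hJ) ltnn.
- by split; [exact: hJs|exact: bounded_cell|rewrite cell_eq].
Qed.

End Logic.

(* Array 2 holds the input of the knapsack algorithm and array 3 its output; array
   5 the sum of all profit components; arrays 6 and 7, for each [k], numerator and
   denominator of the smallest ratio [a_e / b_(k,e)]; array 8 the grid and array 9
   its last index; arrays 10 and 11 the counters of the outer and inner loops. *)
Definition in_n : expr := Read 0 (Const 3).
(** Cell 0 of the input array is the length, so p, q, n and the budget are in cells 1 to 4, followed
    from cell 5 on by rows of n entries: weights, base profits, slopes. Adding 1 to the rounded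
    quotient q / p puts the inverse of [in_E] below p / q. *)
Definition in_E : expr := (Read 0 (Const 2) / Read 0 (Const 1) + Const 1)%E.
Definition in_base (e : expr) : expr := Read 0 (Const 5 + in_n + e)%E.
Definition in_slope (k : expr) (e : expr) : expr :=
  Read 0 (Const 5 + (k + Const 2) * in_n + e)%E.

(** * The program: corner of the parameter set, grid, one knapsack call per grid point *)

Section Code.
Variables (K Q0 : nat) (KP : cmd).

Definition H_expr : expr :=
  (Const (8 * K * K * K.+1) * in_E * eprod (fun=> cell0 5) K.+1)%E.
Definition N_expr : expr := (Const 8 * in_E)%E.
Definition M_expr : expr := (N_expr * eprod (fun=> H_expr) (2 * K))%E.
Definition Z_expr : expr := (N_expr * eprod (fun=> H_expr) K)%E.

(** The profit of an item at the corner of the parameter set, times K and the common denominator.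
    The quotient is exact and the difference is never truncated, because array 6 over array 7 is the
    smallest ratio of its row. *)
Definition F0_expr (e : expr) : expr :=
  esum (fun k => eprod (fun k => Read 7 (Const k)) K / Read 7 (Const k) *
    (Read 7 (Const k) * in_base e - Read 6 (Const k) * in_slope (Const k) e))%E K.

Definition G_expr : expr := (cell0 9 + Const 1)%E.
(** The remainder has to be expressed by division, as the machine has no such operation. *)
Definition digit_expr (k : nat) : expr :=
  (cell0 10 / eprod (fun=> G_expr) k -
   cell0 10 / eprod (fun=> G_expr) k / G_expr * G_expr)%E.
Definition profit_expr (e : expr) : expr :=
  (Z_expr * F0_expr e +
   esum (fun k => Read 8 (digit_expr k) * in_slope (Const k) e) K)%E.

Definition sum_prog : cmd :=
  For 11 (Const K.+1 * in_n)%E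
    (Write 5 (Const 0) (cell0 5 + Read 0 (Const 5 + in_n + cell0 11))%E).

(** A single loop runs over all K n slopes; row and column are recovered from its counter. *)
Definition min_k : expr := (cell0 11 / in_n)%E.
Definition min_e : expr := (cell0 11 - min_k * in_n)%E.
(** Product and sum serve as conjunction and disjunction. A denominator 0 marks a row in which no
    nonzero slope has been met yet. *)
Definition min_test : expr :=
  (in_slope min_k min_e * ((Read 7 min_k == Const 0) +
     (in_base min_e * Read 7 min_k < Read 6 min_k * in_slope min_k min_e)))%E.
Definition min_step : cmd :=
  If min_test
    (Seq (Write 6 min_k (in_base min_e)) (Write 7 min_k (in_slope min_k min_e)))
    Skip.

Definition min_prog : cmd := For 11 (Const K * in_n)%E min_step.

Definition grid_prog : cmd :=
  Seq (Write 8 (Const 0) N_expr)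
    (While (Read 8 (cell0 9) < M_expr)%E
      (Seq (Write 8 (cell0 9 + Const 1)%E
              (Read 8 (cell0 9) + Read 8 (cell0 9) / N_expr)%E)
           (Write 9 (Const 0) (cell0 9 + Const 1)%E))).

(** The part of the knapsack input shared by all calls: length, accuracy 1 / ([Q0] E), number of
    items, budget, weights. Between calls only the profit row behind it is rewritten. *)
Definition header_prog : cmd :=
  Seq (Write 2 (Const 0) (Const 4 + Const 2 * in_n)%E)
  (Seq (Write 2 (Const 1) (Const 1))
  (Seq (Write 2 (Const 2) (Const Q0 * in_E)%E)
  (Seq (Write 2 (Const 3) in_n)
  (Seq (Write 2 (Const 4) (Read 0 (Const 4)))
  (For 11 in_n
    (Write 2 (Const 5 + cell0 11)%E (Read 0 (Const 5 + cell0 11)%E))))))).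

Definition profit_prog : cmd :=
  For 11 in_n (Write 2 (Const 5 + in_n + cell0 11)%E (profit_expr (cell0 11))).

Definition append_prog : cmd :=
  Seq (For 11 in_n (Write 1 (Const 1 + cell0 1 + cell0 11)%E
                            (Read 3 (Const 1 + cell0 11)%E)))
      (Write 1 (Const 0) (cell0 1 + in_n)%E).

Definition main_prog : cmd :=
  For 10 (eprod (fun=> G_expr) K)
    (Seq profit_prog (Seq (Call KP 2 3) append_prog)).

Definition pk_prog : cmd :=
  Seq sum_prog (Seq min_prog (Seq grid_prog (Seq header_prog main_prog))).

End Code.

(* An integer substitute for a geometric progression: as [vgrid N i >= N], each step
   multiplies by a factor between [1 + 1 / (2 * N)] and [1 + 1 / N]. *)
Fixpoint vgrid (N i : nat) : nat :=
  if i is i'.+1 then vgrid N i' + vgrid N i' %/ N else N.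

Lemma codom_ord (n : nat) (g : nat -> nat) : codom (fun e : 'I_n => g e) = mkseq g n.
Proof. by rewrite /codom /image_mem /mkseq -val_enum_ord -map_comp. Qed.

Lemma get_seq_eq f s :
  (forall i, i <= size s -> f i = nth 0 (size s :: s) i) -> get_seq f = s.
Proof.
move=> h; rewrite /get_seq h //=; apply: (@eq_from_nth _ 0); rewrite size_mkseq // => i hi.
by rewrite nth_mkseq // h.
Qed.

(** Converts the bound on cells into the word bound demanded by the called program: length and
    entries are at most Y - 1, and 2 + 2 (Y - 1) = 2 Y <= Y^2. *)
Lemma word_bound_get_seq (d Y : nat) (m : memory) (a : nat) :
  1 < Y -> bounded Y m -> word_bound d (get_seq (m a)) <= (Y ^ 2) ^ d.
Proof.
move=> Y1 hm; rewrite /word_bound.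
have h1 : size (get_seq (m a)) < Y by rewrite size_mkseq.
have h2 : \max_(v <- get_seq (m a)) v < Y.
  rewrite -[Y]prednK ?(ltnW Y1) // ltnS; apply/bigmax_leqP_seq => v /mapP[i _ ->] _.
  by rewrite -ltnS prednK ?(ltnW Y1).
case: d => [|d]; first by rewrite !expn0.
by rewrite leq_exp2r //; nia.
Qed.

(** * Correctness and running time of the program, stated over natural numbers only *)

Section Correctness.
Variables (K Q0 n : nat) (f0 : nat -> nat).
Hypothesis f0n : f0 3 = n.

(* [1 / nE] is a lower bound for the accuracy, [nS] the sum of all profit
   components, [K * nS ^ K.+1] a bound for the components of all solutions after
   scaling, and [nH] the largest ratio between consecutive weights that has to be
   distinguished.  Weights range over [nN .. nM], the constant one being [nZ]. *)
Definition nbase (e : nat) := f0 (5 + n + e).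
Definition nslope (k e : nat) := f0 (5 + (k + 2) * n + e).
Definition nE := f0 2 %/ f0 1 + 1.
Definition nS := \sum_(i < K.+1 * n) f0 (5 + n + i).
Definition nH := 8 * K * K * K.+1 * nE * nS ^ K.+1.
Definition nN := 8 * nE.
Definition nM := nN * nH ^ (2 * K).
Definition nZ := nN * nH ^ K.

(* [N] is the number of entries of the [K * n] slope matrix read so far. *)
Definition min_ratio (num den : nat -> nat) (N k : nat) : Prop :=
  [/\ den k = 0 -> forall e, e < n -> k * n + e < N -> nslope k e = 0,
      den k <> 0 -> exists e, [/\ e < n, num k = nbase e & den k = nslope k e]
    & forall e, e < n -> k * n + e < N -> num k * nslope k e <= nbase e * den k].

Definition nF0 (num den : nat -> nat) (e : nat) : nat :=
  \sum_(k < K) (\prod_(k < K) den k) %/ den k *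
     (den k * nbase e - num k * nslope k e).

(* The [K] digits of [i] in base [L.+1] select the weights of grid point [i]. *)
Definition nprofit (num den v : nat -> nat) (L i e : nat) : nat :=
  nZ * nF0 num den e +
  \sum_(k < K) v (i %/ L.+1 ^ k %% L.+1) * nslope k e.

Lemma eval_E m : m 0 = f0 -> eval m in_E = nE.
Proof. by move=> h; rewrite /= h. Qed.

Lemma eval_slope m k e : m 0 = f0 ->
  eval m (in_slope k e) = nslope (eval m k) (eval m e).
Proof. by move=> h; rewrite /= h f0n. Qed.

Lemma eval_base m e : m 0 = f0 -> eval m (in_base e) = nbase (eval m e).
Proof. by move=> h; rewrite /= h f0n. Qed.

Lemma eval_H m : m 0 = f0 -> m 5 0 = nS -> eval m (H_expr K) = nH.
Proof.
by move=> h h5; rewrite /nH /H_expr 2!eval_bin eval_E // eval_epow eval_cell0 h5.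
Qed.

Lemma eval_N m : m 0 = f0 -> eval m N_expr = nN.
Proof. by move=> h; rewrite /= h. Qed.

Lemma eval_M m : m 0 = f0 -> m 5 0 = nS -> eval m (M_expr K) = nM.
Proof.
by move=> h h5; rewrite /M_expr eval_bin eval_epow eval_N // eval_H.
Qed.

Lemma eval_profit m L num den v : m 0 = f0 -> m 5 0 = nS -> m 6 = num ->
  m 7 = den -> m 8 = v -> m 9 0 = L ->
  eval m (profit_expr K (cell0 11)) = nprofit num den v L (m 10 0) (m 11 0).
Proof.
move=> h0 h5 h6 h7 h8 h9; rewrite /profit_expr /nprofit /nZ /Z_expr.
rewrite 3!eval_bin eval_epow eval_N // eval_H // !eval_esum.
congr (_ + _); first congr (_ * _).
  apply: eq_bigr => k _; rewrite !eval_bin eval_eprod /= !h6 !h7 !h0 !f0n.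
  by rewrite /nbase /nslope.
apply: eq_bigr => k _; rewrite eval_bin eval_read /digit_expr.
rewrite !eval_bin !eval_epow /= h8 h0 f0n h9 !addn1.
congr (v _ * _); rewrite {1}(divn_eq (m 10 0 %/ L.+1 ^ k) L.+1); lia.
Qed.

Variables B Y D : nat.
Hypotheses (Y_gt1 : 1 < Y) (YDB : Y ^ D <= B).
Let Y0 : 0 < Y. Proof. exact: ltnW. Qed.

Lemma run_sum m : m 0 = f0 -> m 5 0 = 0 -> bounded Y m ->
  cdeg (sum_prog K) <= D -> nS < Y -> K.+1 * n < Y ->
  run B (sum_prog K) m ((K.+1 * n).+1 * (ccost (sum_prog K)).+1)
    (fun m' => [/\ same [:: 5; 11] m m', m' 5 0 = nS & bounded Y m']).
Proof.
move=> h0 h5 hm hD hS hN.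
pose J j m' := same [:: 5; 11] m m' /\ m' 5 0 = \sum_(i < j) f0 (5 + n + i).
apply: run_weaken (run_for (J := J) Y_gt1 YDB hm hN hD _ _
   (T := ccost (Write 5 (Const 0) (cell0 5 + Read 0 (Const 5 + in_n + cell0 11))%E)) _ _).
- by rewrite ccost_for.
- by move=> m' [[hs h] hb]; split.
- by move=> j m' v [hs h]; split; [exact: same_cell|rewrite cell_ne].
- by move=> j m' [hs h]; rewrite /= hs // h0 f0n.
- move=> j m' hj [hs h] hb h11.
  have hle : \sum_(i < j.+1) f0 (5 + n + i) <= nS.
    rewrite /nS (big_ord_widen _ (fun i => f0 (5 + n + i)) hj).
    by rewrite [leqRHS](bigID (fun i : 'I_ _ => i < j.+1)) leq_addr.
  have ev : eval m' (cell0 5 + Read 0 (Const 5 + in_n + cell0 11))%E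
     = \sum_(i < j.+1) f0 (5 + n + i).
    by rewrite big_ord_recr /= h hs // h0 f0n h11.
  apply: (run_write Y_gt1 YDB) => //; first exact: cdeg_for hD.
  rewrite ev; split; last by rewrite cell_ne.
  + by split; [exact: same_cell|rewrite /= cell_eq].
  + by apply: bounded_cell => //; exact: leq_ltn_trans hle hS.
- by split=> //; rewrite h5 big_ord0.
Qed.

Lemma run_min m : m 0 = f0 -> (forall i, m 7 i = 0) -> bounded Y m ->
  cdeg (min_prog K) <= D -> K * n < Y ->
  run B (min_prog K) m ((K * n).+1 * (ccost (min_prog K)).+1)
    (fun m' => [/\ same [:: 6; 7; 11] m m', bounded Y m' &
       forall k, k < K -> min_ratio (m' 6) (m' 7) (K * n) k]).
Proof.
move=> h0 h7 hm hD hN.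
pose J j m' := same [:: 6; 7; 11] m m' /\
  forall k, k < K -> min_ratio (m' 6) (m' 7) j k.
apply: run_weaken (run_for (J := J) Y_gt1 YDB hm hN hD _ _
  (T := ccost min_step) _ _).
- by rewrite ccost_for.
- by move=> m' [[hs h] hb]; split.
- by move=> j m' v [hs h]; split; [exact: same_cell|rewrite !cell_ne].
- by move=> j m' [hs h]; rewrite /= hs // h0 f0n.
- move=> j m' hj [hs h] hb h11.
  have n0 : 0 < n by move: hj; case: (n) => //; rewrite muln0.
  pose k := j %/ n; pose e := j %% n.
  have jE : j = k * n + e := divn_eq j n.
  have eE : j - k * n = e by rewrite jE addKn.
  have en : e < n by rewrite ltn_pmod.
  have kK : k < K by rewrite ltn_divLR.
  have fE i : m' 0 i = f0 i by rewrite hs // h0.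
  have ek : eval m' min_k = k by rewrite /= fE f0n h11.
  have ee : eval m' min_e = e by rewrite /= fE f0n h11 eE.
  have es : eval m' (in_slope min_k min_e) = nslope k e.
    by rewrite eval_slope ?ek ?ee // hs.
  have eb : eval m' (in_base min_e) = nbase e.
    by rewrite eval_base ?ee // hs.
  have et : eval m' min_test = nslope k e * ((m' 7 k == 0) + (nbase e * m' 7 k < m' 6 k * nslope k e)).
    by rewrite -es -eb -ek.
  have fY i : f0 i < Y by rewrite -fE.
  (* The cell reached at step [j] is [(k, e)]; only the row [k] changes. *)
  have step num den : (forall k', k' != k -> num k' = m' 6 k' /\ den k' = m' 7 k') ->
      min_ratio num den j.+1 k -> forall k', k' < K -> min_ratio num den j.+1 k'.
    move=> hne hk k' k'K; have [->//|nk] := eqVneq k' k.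
    have [hn hd] := hne _ nk; rewrite /min_ratio hn hd.
    have [A1 A2 A3] := h _ k'K.
    have lt e' : e' < n -> k' * n + e' < j.+1 -> k' * n + e' < j.
      move=> e'n; rewrite ltnS leq_eqVlt => /orP[/eqP E|//]; by case/eqP: nk; move: E; rewrite jE; nia.
    by split=> // [d0 e' e'n /(lt _ e'n)|e' e'n /(lt _ e'n)]; [exact: A1|exact: A3].
  have [A1 A2 A3] := h _ kK.
  have split_lt e' : e' < n -> k * n + e' < j.+1 -> k * n + e' < j \/ e' = e.
    by move=> e'n; rewrite ltnS leq_eqVlt => /orP[/eqP E|]; [right; move: E; rewrite jE; lia|left].
  have [hDt hDs _] := cdeg_if (cdeg_for hD).
  apply: (run_if Y_gt1 YDB hb hDt); rewrite et => ht.
    have s_gt0 : 0 < nslope k e by move: ht; rewrite muln_eq0 negb_or lt0n => /andP[].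
    pose m1 := set_cell m' 6 k (nbase e).
    have hb1 : bounded Y m1 by apply: bounded_cell => //; exact: fY.
    have ek1 : eval m1 min_k = k by rewrite -ek.
    have es1 : eval m1 (in_slope min_k min_e) = nslope k e by rewrite -es.
    apply: run_weaken (leq_addr 1 _) (fun _ => id) _.
    apply: run_seq; apply: (run_write Y_gt1 YDB hb (cdeg_seq hDs).1).
    rewrite ek eb; apply: (run_write Y_gt1 YDB hb1 (cdeg_seq hDs).2).
    rewrite ek1 es1; split; last by rewrite !cell_ne.
      split; first by do 2!apply: same_cell => //.
      apply: step => [k' /negbTE nk|].
        by rewrite /m1 /set_cell /set_array /= nk.
      rewrite /min_ratio /m1 /set_cell /set_array /= eqxx; split.
      - by move=> E; rewrite E in s_gt0.
      - by move=> _; exists e.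
      move=> e' e'n /(split_lt _ e'n)[lt|->]; last by rewrite mulnC.
      have {}A3 := A3 _ e'n lt; have {}A1 := A1 _ _ e'n lt.
      (* Without an earlier ratio, all earlier slopes of the row are 0. *)
      have [d0|d0] := posnP (m' 7 k); first by rewrite A1 // muln0.
      move: ht; rewrite muln_eq0 negb_or addn_eq0 negb_and !eqb0 !negbK.
      rewrite (gtn_eqF d0) /= => /andP[_ lt2].
      (* Transitivity of the order of ratios: the new ratio is below the old minimum, which is at
         most the ratio of e'. Cross-multiplication by the old denominator links the two. *)
      rewrite -(leq_pmul2l d0).
      have := leq_mul (ltnW lt2) (leqnn (nslope k e')).
      have := leq_mul A3 (leqnn (nslope k e)).
      by clear; nia.
    by apply: bounded_cell => //; exact: fY.
  exists 1, m'; split; [exact: exec_skip|by rewrite addn1|split=> //].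
  split=> //; apply: step => //; split=> //.
  - move=> d0 e' e'n /(split_lt _ e'n)[|->]; first exact: A1.
    by apply/eqP; move: ht => /eqP; rewrite d0 muln_eq0 orbF.
  - move=> e' e'n /(split_lt _ e'n)[|->]; first exact: A3.
    move/eqP: ht; rewrite muln_eq0 => /orP[/eqP->|]; first by rewrite muln0.
    by rewrite addn_eq0 => /andP[_]; rewrite eqb0 -leqNgt.
split=> // k _; split; [by move=> _ e _; lia|by rewrite h7|by move=> e _; lia].
Qed.

Variable L : nat.

(** The program does not know the length of the grid beforehand. The first two hypotheses single out
    L as the first index at which [nM] is reached, so the loop makes exactly L rounds. *)
Lemma run_grid m : (forall i, i < L -> vgrid nN i < nM) -> nM <= vgrid nN L ->
  m 0 = f0 -> m 5 0 = nS -> m 9 0 = 0 -> bounded Y m ->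
  cdeg (grid_prog K) <= D -> (forall i, i <= L -> vgrid nN i < Y) -> L < Y ->
  run B (grid_prog K) m (L.+1 * ccost (grid_prog K))
    (fun m' => [/\ same [:: 8; 9] m m', bounded Y m', m' 9 0 = L &
       forall i, i <= L -> m' 8 i = vgrid nN i]).
Proof.
move=> ltL geL h0 h5 h9 hm /cdeg_seq[hD0 /cdeg_while[hDe /cdeg_seq[hD1 hD2]]] hV hL.
pose J j m' := [/\ same [:: 8; 9] m m', bounded Y m', m' 9 0 = j &
   forall i, i <= j -> m' 8 i = vgrid nN i].
set c1 := Write 8 _ _ in hD1; set c2 := Write 9 _ _ in hD2.
set e := (_ < _)%E in hDe.
apply: (@run_weaken _ _ _ (ccost (Write 8 (Const 0) N_expr) +
   (L * (expr_cost e + (ccost c1 + ccost c2).+1).+1 + (expr_cost e).+1)).+1 _ (J L)) => //.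
  by rewrite /grid_prog -/c1 -/c2 -/e; cbn [ccost]; nia.
apply: run_seq; apply: (run_write Y_gt1 YDB hm hD0).
rewrite eval_N //; apply: (run_while (J := J) Y_gt1 YDB) => //.
- by move=> j m' [].
- move=> j m' hj [hs hb hj9 h8].
  have m0 : m' 0 = f0 by rewrite hs.
  have m5 : m' 5 0 = nS by rewrite hs.
  split.
    by rewrite /e eval_bin eval_read eval_cell0 eval_M // hj9 h8 //= ltL.
  apply: run_seq; apply: (run_write Y_gt1 YDB hb hD1).
  have -> : eval m' (cell0 9 + Const 1) = j.+1 by rewrite /= hj9 addn1.
  have -> : eval m' (Read 8 (cell0 9) + Read 8 (cell0 9) / N_expr) = vgrid nN j.+1.
    by rewrite 2!eval_bin eval_N // eval_read eval_cell0 hj9 h8.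
  apply: (run_write Y_gt1 YDB _ hD2); first by apply: bounded_cell => //; exact: hV.
  rewrite /= cell_ne // hj9 addn1; split; rewrite ?cell_eq //.
  + by do 2!apply: same_cell => //.
  + apply: bounded_cell; last exact: leq_ltn_trans hL.
    by apply: bounded_cell => //; exact: (hV j.+1).
  + move=> i hi; rewrite cell_ne // cell_eq; case: eqP => [->//|/eqP ni].
    by apply: h8; rewrite -ltnS ltn_neqAle ni.
- move=> m' [hs hb hj9 h8].
  have m0 : m' 0 = f0 by rewrite hs.
  have m5 : m' 5 0 = nS by rewrite hs.
  by rewrite /e eval_bin eval_read eval_cell0 eval_M // hj9 h8 //= ltnNge geL.
split; [exact: same_cell| |by rewrite cell_ne|].
  by apply: bounded_cell => //; exact: (hV 0).
by move=> i; rewrite leqn0 => /eqP->; rewrite cell_eq.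
Qed.

Lemma run_header m : m 0 = f0 -> bounded Y m ->
  cdeg (header_prog Q0) <= D -> 4 + 2 * n < Y -> Q0 * nE < Y ->
  run B (header_prog Q0) m (n.+2 * ccost (header_prog Q0))
    (fun m' => [/\ same [:: 2; 11] m m', bounded Y m' &
       forall i, i < 5 + n -> m' 2 i =
         nth 0 [:: 4 + 2 * n, 1, Q0 * nE, n, f0 4 & mkseq (fun e => f0 (5 + e)) n] i]).
Proof.
move=> h0 hm hD hn hq.
have fY i : f0 i < Y by rewrite -h0.
move: hD => /cdeg_seq[hD0 /cdeg_seq[hD1 /cdeg_seq[hD2 /cdeg_seq[hD3 /cdeg_seq[hD4 hD5]]]]].
set hs := [:: _, _, _, _, _ & _].
pose J j m' := [/\ same [:: 2; 11] m m', bounded Y m' & forall i, i < j -> m' 2 i = nth 0 hs i].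
have hsY k : k < 5 -> nth 0 hs k < Y.
  by case: k => [|[|[|[|[|]]]]] //= _; rewrite -?f0n.
have J0 : J 0 m by split.
have step k e c m1 T Q : J k m1 -> cdeg (Write 2 (Const k) e) <= D ->
    k < 5 -> eval m1 e = nth 0 hs k ->
    (forall m2, J k.+1 m2 -> run B c m2 T Q) ->
    run B (Seq (Write 2 (Const k) e) c) m1 (ccost (Write 2 (Const k) e) + T).+1 Q.
  move=> [hs1 hb1 h1] hd k5 he hc; have hY : eval m1 e < Y by rewrite he hsY.
  apply: run_seq; apply: (run_write Y_gt1 YDB) => //.
  apply: hc; split; [exact: same_cell|exact: bounded_cell|].
  move=> i; rewrite ltnS leq_eqVlt cell_eq /= he => /orP[/eqP->|hi]; first by rewrite eqxx.
  by rewrite ltn_eqF // h1.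
apply: (@run_weaken _ _ _ (ccost (Write 2 (Const 0) (Const 4 + Const 2 * in_n)%E) +
  (ccost (Write 2 (Const 1) (Const 1)) + (ccost (Write 2 (Const 2) (Const Q0 * in_E)%E) +
  (ccost (Write 2 (Const 3) in_n) + (ccost (Write 2 (Const 4) (Read 0 (Const 4))) +
   n.+1 * (ccost (Write 2 (Const 5 + cell0 11)%E (Read 0 (Const 5 + cell0 11)%E))
     + ccost (For 11 in_n Skip))).+1).+1).+1).+1).+1 _ (J (5 + n))) => //.
  by rewrite ccost_for /header_prog; cbn [ccost]; nia.
have Jn k m' : J k m' -> m' 0 = f0 by move=> [hs' _ _]; rewrite hs'.
rewrite /header_prog.
apply: (step 0 _ _ _ _ _ J0 hD0) => [//||m1 J1]; first by rewrite /= h0 f0n.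
apply: (step 1 _ _ _ _ _ J1 hD1) => [//|//|m2 J2].
apply: (step 2 _ _ _ _ _ J2 hD2) => [//||m3 J3]; first by rewrite eval_bin eval_E ?(Jn _ _ J2).
apply: (step 3 _ _ _ _ _ J3 hD3) => [//||m4 J4]; first by rewrite /= (Jn _ _ J3).
apply: (step 4 _ _ _ _ _ J4 hD4) => [//||m5 J5]; first by rewrite /= (Jn _ _ J4).
have [hs5 hb5 h5] := J5.
pose J' j m' := same [:: 2; 11] m m' /\ forall i, i < 5 + j -> m' 2 i = nth 0 hs i.
apply: run_weaken (run_for (J := J') Y_gt1 YDB hb5 _ hD5 _ _
  (T := ccost (Write 2 (Const 5 + cell0 11)%E (Read 0 (Const 5 + cell0 11)%E))) _ _) => //.
- by move=> m' [[]].
- by rewrite -f0n; exact: fY.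
- by move=> j m' v [hs1 h1]; split; [exact: same_cell|rewrite cell_ne].
- by move=> j m' [hs1 _]; rewrite /= hs1 // h0.
move=> j m' hj [hs1 h1] hb1 h11.
apply: (run_write Y_gt1 YDB hb1 (cdeg_for hD5)).
have -> : eval m' (Read 0 (Const 5 + cell0 11)) = f0 (5 + j) by rewrite /= h11 hs1 // h0.
have -> : eval m' (Const 5 + cell0 11) = 5 + j by rewrite /= h11.
split; [|exact: bounded_cell|by rewrite cell_ne].
split; [exact: same_cell|].
move=> i; rewrite addnS ltnS leq_eqVlt cell_eq => /orP[/eqP->|hi].
  by rewrite eqxx /= nth_mkseq.
by rewrite ltn_eqF // h1.
Qed.

Variables num den v : nat -> nat.

Definition header : seq nat :=
  [:: 4 + 2 * n, 1, Q0 * nE, n, f0 4 & mkseq (fun e => f0 (5 + e)) n].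

Definition arrays_ok (m : memory) : Prop :=
  [/\ m 0 = f0, m 5 0 = nS & m 9 0 = L] /\ [/\ m 6 = num, m 7 = den & m 8 = v].

Lemma arrays_ok_same S m m' : all (fun a => a \notin S) [:: 0; 5; 6; 7; 8; 9] ->
  same S m m' -> arrays_ok m -> arrays_ok m'.
Proof.
case/and5P=> a0 a5 a6 a7 /and3P[a8 a9 _] hs [[h0 h5 h9] [h6 h7 h8]].
by rewrite /arrays_ok !hs.
Qed.

Lemma run_profit i m : arrays_ok m -> m 10 0 = i -> bounded Y m ->
  (forall j, j < 5 + n -> m 2 j = nth 0 header j) ->
  cdeg (profit_prog K) <= D -> (forall e, e < n -> nprofit num den v L i e < Y) ->
  run B (profit_prog K) m (n.+1 * (ccost (profit_prog K)).+1)
    (fun m' => [/\ same [:: 2; 11] m m', bounded Y m' &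
       forall j, j < 5 + n + n ->
         m' 2 j = nth 0 (header ++ mkseq (nprofit num den v L i) n) j]).
Proof.
move=> hA h10 hm h2 hD hY; set hs := _ ++ _.
have nY : n < Y by rewrite -f0n; case: hA => [[<- _ _] _]; exact: hm.
pose J j m' := same [:: 2; 11] m m' /\ forall e, e < 5 + n + j -> m' 2 e = nth 0 hs e.
have hA' m' : same [:: 2; 11] m m' -> arrays_ok m'.
  by move=> h; exact: arrays_ok_same h hA.
have hn' m' : same [:: 2; 11] m m' -> eval m' in_n = n.
  by move=> /hA'[[h0 _ _] _]; rewrite /= h0.
apply: run_weaken (run_for (J := J) Y_gt1 YDB hm nY hD _ _
  (T := ccost (Write 2 (Const 5 + in_n + cell0 11)%E (profit_expr K (cell0 11)))) _ _).
- by rewrite ccost_for.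
- by move=> m' [[]].
- by move=> j m' x [hs1 h1]; split; [exact: same_cell|rewrite cell_ne].
- by move=> j m' [/hn'].
- move=> j m' hj [hs1 h1] hb h11.
  apply: (run_write Y_gt1 YDB hb (cdeg_for hD)).
  have -> : eval m' (profit_expr K (cell0 11)) = nprofit num den v L i j.
    have [[a0 a5 a9] [a6 a7 a8]] := hA' _ hs1.
    by rewrite (eval_profit a0 a5 a6 a7 a8 a9) h11 hs1 // h10.
  have -> : eval m' (Const 5 + in_n + cell0 11) = 5 + n + j.
    by rewrite 2!eval_bin (hn' _ hs1) /= h11.
  split; [|by apply: bounded_cell => //; exact: hY|by rewrite cell_ne].
  split; [exact: same_cell|].
  move=> e; rewrite addnS ltnS leq_eqVlt cell_eq => /orP[/eqP->|he].
    rewrite eqxx nth_cat /header /= size_mkseq ifF; last by lia.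
    by rewrite nth_mkseq; [congr nprofit|]; lia.
  by rewrite ltn_eqF // h1.
split=> // e he; rewrite nth_cat /header [size _]/= size_mkseq ifT; last by lia.
by apply: h2; lia.
Qed.

(** The length cell is raised only after all entries are written. The invariant thus speaks of raw
    cells, as the new ones are not yet visible to [get_seq]. *)
Lemma run_append m : m 0 = f0 -> bounded Y m -> cdeg append_prog <= D ->
  m 1 0 + n < Y ->
  run B append_prog m (n.+2 * (ccost append_prog).+1)
    (fun m' => [/\ same [:: 1; 11] m m', bounded Y m' &
       get_seq (m' 1) = get_seq (m 1) ++ mkseq (fun e => m 3 e.+1) n]).
Proof.
move=> h0 hm /cdeg_seq[hD1 hD2] hY.
have nY : n < Y by rewrite -f0n -h0.
pose J j m' := same [:: 1; 11] m m' /\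
  forall e, m' 1 e = if m 1 0 < e <= m 1 0 + j then m 3 (e - m 1 0) else m 1 e.
pose c := Write 1 (Const 1 + cell0 1 + cell0 11)%E (Read 3 (Const 1 + cell0 11)%E).
pose c' := Write 1 (Const 0) (cell0 1 + in_n)%E.
apply: (@run_weaken _ _ _ (n.+1 * (ccost c + ccost (For 11 in_n Skip)) + ccost c').+1 _ _ _ _ (fun _ => id)).
  by rewrite ccost_for /append_prog -/c -/c'; cbn [ccost]; nia.
apply: run_seq; apply: run_weaken (run_for (J := J) Y_gt1 YDB hm nY hD1 _ _
  (T := ccost c) _ _) => //.
- move=> m' [[hs h1] hb]; apply: (run_write Y_gt1 YDB hb hD2).
  have h10 : m' 1 0 = m 1 0 by rewrite h1.
  have -> : eval m' (cell0 1 + in_n)%E = m 1 0 + n by rewrite /= h10 hs // h0 f0n.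
  split; [exact: same_cell|exact: bounded_cell|].
  rewrite /get_seq; apply: (@eq_from_nth _ 0).
    by rewrite size_cat !size_mkseq cell_eq.
  rewrite size_mkseq cell_eq /= => i hi.
  rewrite nth_cat size_mkseq nth_mkseq // cell_eq /= h1.
  case: (ltnP i (m 1 0)) => h; first by rewrite nth_mkseq // leqNgt ltnS h.
  rewrite ltnS h hi nth_mkseq; last by lia.
  by rewrite subSn.
- by move=> j m' x [hs1 h1]; split; [exact: same_cell|move=> e; rewrite cell_ne].
- by move=> j m' [hs _]; rewrite /= hs // h0.
- move=> j m' hj [hs h1] hb h11.
  apply: (run_write Y_gt1 YDB hb (cdeg_for hD1)).
  have h10 : m' 1 0 = m 1 0 by rewrite h1.
  have -> : eval m' (Read 3 (Const 1 + cell0 11)) = m 3 j.+1 by rewrite /= h11 hs.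
  have -> : eval m' (Const 1 + cell0 1 + cell0 11) = m 1 0 + j.+1 by rewrite /= h11 h10; lia.
  split; [|exact: bounded_cell|by rewrite cell_ne].
  split; [exact: same_cell|].
  move=> e; rewrite cell_eq h1; case: eqP => [->|ne].
    by rewrite addKn ifT //; lia.
  by congr (if _ then _ else _); lia.
- split=> // e; rewrite ifF //; lia.
Qed.

(** [Good] stays abstract: what makes a solution good is an inequality between real numbers, about
    which the analysis of the program need not know anything. It becomes [good_solution] later. *)
Variables (KP : cmd) (d T : nat) (Good : ('I_n -> nat) -> {set 'I_n} -> Prop).
Hypothesis Y2B : (Y ^ 2) ^ d <= B.

Definition KP_input (pr : 'I_n -> nat) : seq nat :=
  [:: 1, Q0 * nE & encode (f0 4) (fun e : 'I_n => f0 (5 + e)) [:: pr]].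

Hypothesis KP_spec : forall pr, word_bound d (KP_input pr) <= B ->
  exists t x, [/\ runs B KP (KP_input pr) t (encode_solution x), t <= T & Good pr x].

Definition profit_at (i : nat) (e : 'I_n) : nat := nprofit num den v L i e.

Definition body_cost : nat :=
  (ccost (profit_prog K)).+1 + 10 + 2 * (ccost append_prog).+1.

Lemma run_body i m S : arrays_ok m -> m 10 0 = i -> bounded Y m ->
  (forall j, j < 5 + n -> m 2 j = nth 0 header j) ->
  cdeg (Seq (profit_prog K) (Seq (Call KP 2 3) append_prog)) <= D ->
  (forall e, e < n -> nprofit num den v L i e < Y) ->
  m 1 0 + n < Y ->
  get_seq (m 1) = flatten [seq encode_solution x | x : {set 'I_n} <- S] ->
  run B (Seq (profit_prog K) (Seq (Call KP 2 3) append_prog)) m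
    (body_cost * (n + T + 1))
    (fun m' => [/\ same [:: 1; 2; 3; 11] m m', bounded Y m',
       (forall j, j < 5 + n -> m' 2 j = nth 0 header j) &
       exists2 x, Good (profit_at i) x &
         get_seq (m' 1) = flatten [seq encode_solution x | x <- rcons S x]]).
Proof.
move=> hA h10 hm h2 /cdeg_seq[hD1 /cdeg_seq[_ hD2]] hY hY1 hS.
have [[a0 _ _] _] := hA.
apply: (@run_weaken _ _ _ (n.+1 * (ccost (profit_prog K)).+1 +
  (((4 + 2 * n) + T + n).+1 + n.+2 * (ccost append_prog).+1).+1).+1 _ _ _ _ (fun _ => id)).
  by rewrite /body_cost; nia.
apply: run_seq; apply: run_weaken (leqnn _) _ (run_profit hA h10 hm h2 hD1 hY).
move=> m1 [hs1 hb1 hm1].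
have in1 : get_seq (m1 2) = KP_input (profit_at i).
  apply: get_seq_eq => j.
  rewrite /KP_input /encode /= cats0 size_cat !size_codom card_ord => hj.
  rewrite hm1; last by lia.
  rewrite (codom_ord n (fun e => f0 (5 + e))) (codom_ord n (nprofit num den v L i)).
  by congr (nth 0 (_ :: _) j); lia.
apply: run_seq.
have [|t [x [[m2 hx hout] ht hG]]] := @KP_spec (profit_at i).
  rewrite -in1; apply: leq_trans Y2B; exact: word_bound_get_seq.
exists (size (get_seq (m1 2)) + t + size (output_of m2)).+1.
exists (set_array m1 3 (put_seq (output_of m2) (m1 3))); split.
- by apply: exec_call; rewrite in1.
- rewrite -hout size_codom card_ord in1 /= /encode /= cats0 size_cat !size_codom card_ord; lia.
rewrite -hout.
set m3 := set_array _ _ _.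
have hs3 a : a != 3 -> m3 a = m1 a by rewrite /m3 /set_array => /negbTE->.
have h33 e : m3 3 e.+1 = if e < n then nth 0 (encode_solution x) e else m1 3 e.+1.
  rewrite /m3 /set_array /put_seq /=; case: ltnP => he.
    by apply: set_nth_default; rewrite size_codom card_ord.
  by rewrite nth_default // size_codom card_ord.
have hb3 : bounded Y m3.
  move=> a e; have [->|na] := eqVneq a 3; last by rewrite hs3.
  case: e => [|e].
    by rewrite /m3 /set_array /put_seq /= size_codom card_ord; lia.
  rewrite h33; case: ifP => // he.
  rewrite -[nth _ _ _]/(nth 0 (codom _) _) (nth_map (Ordinal he)) ?size_enum_ord //.
  by apply: leq_ltn_trans Y_gt1; apply: leq_b1.
have h10' : m1 1 = m 1 by rewrite hs1.
apply: run_weaken (leqnn _) _ (run_append _ hb3 hD2 _).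
- move=> m4 [hs4 hb4 hg4]; split=> //.
  + move=> a; rewrite !inE !negb_or => /and4P[n1 n2 n3 n11].
    by rewrite hs4 ?inE ?negb_or ?n1 // hs3 // hs1 // !inE negb_or n2.
  + move=> j hj; rewrite hs4 // hs3 // hm1; last by lia.
    by rewrite nth_cat /header [size _]/= size_mkseq ifT //; lia.
  exists x => //; rewrite hg4 hs3 // h10' hS map_rcons flatten_rcons; congr (_ ++ _).
  apply: (@eq_from_nth _ 0); rewrite size_mkseq ?size_codom ?card_ord // => e he.
  by rewrite nth_mkseq // h33 he.
- by rewrite hs3 // hs1.
- by rewrite hs3 // h10'.
Qed.

Lemma run_main m : arrays_ok m -> bounded Y m -> (forall i, m 1 i = 0) ->
  (forall j, j < 5 + n -> m 2 j = nth 0 header j) ->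
  cdeg (main_prog K KP) <= D ->
  (forall i e, e < n -> nprofit num den v L i e < Y) ->
  L.+1 ^ K < Y -> L.+1 ^ K * n < Y ->
  run B (main_prog K KP) m
    ((L.+1 ^ K).+1 * (body_cost * (n + T + 1) +
       ccost (For 10 (eprod (fun=> G_expr) K) Skip)))
    (fun m' => exists S : seq {set 'I_n}, [/\
       output_of m' = flatten [seq encode_solution x | x <- S],
       forall x, x \in S -> exists i, Good (profit_at i) x &
       forall i, i < L.+1 ^ K -> exists2 x, x \in S & Good (profit_at i) x]).
Proof.
move=> hA hm h1 h2 hD hY hG hGn; set N := L.+1 ^ K in hG hGn *.
pose J i m' := [/\ same [:: 1; 2; 3; 10; 11] m m',
    (forall j, j < 5 + n -> m' 2 j = nth 0 header j) &
    exists S : seq {set 'I_n}, [/\ size S = i,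
       get_seq (m' 1) = flatten [seq encode_solution x | x <- S],
       forall x, x \in S -> exists k, Good (profit_at k) x &
       forall k, k < i -> exists2 x, x \in S & Good (profit_at k) x]].
have hA' m' : same [:: 1; 2; 3; 10; 11] m m' -> arrays_ok m'.
  by move=> h; exact: arrays_ok_same h hA.
apply: run_weaken (leqnn _) _ (run_for (J := J) Y_gt1 YDB hm hG hD _ _
  (T := body_cost * (n + T + 1)) _ _).
- by move=> m' [[_ _ [S [_ e h1' h]]] _]; exists S.
- by move=> j m' x [hs1 h21 hS]; split; [exact: same_cell|rewrite cell_ne|rewrite cell_ne].
- by move=> j m' [/hA'[[_ _ h9] _] _ _]; rewrite eval_epow /= h9 addn1.
- move=> i m' hi [hs h22 [S [sS eS hS1 hS]]] hb h10.
  (* Every stored solution occupies n entries, so the output length is determined by the round. *)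
  have h10' : m' 1 0 = i * n.
    have /(congr1 size) := eS; rewrite size_mkseq => ->.
    rewrite size_flatten /shape -map_comp sumnE big_map.
    rewrite (eq_bigr (fun=> n)) => [|x _]; last by rewrite /= size_codom card_ord.
    by rewrite big_const_seq count_predT sS iter_addn addn0 mulnC.
  apply: run_weaken (leqnn _) _ (run_body (hA' _ hs) h10 hb h22 (cdeg_for hD) (hY i) _ eS).
    move=> m1 [hs1 hb1 h21 [x hx ex]]; split=> //; last by rewrite hs1.
    split=> //.
      move=> a; rewrite !inE !negb_or => /and5P[n1 n2 n3 n4 n5].
      by rewrite hs1 ?hs // !inE ?negb_or ?n1 ?n2 ?n3 ?n4.
    exists (rcons S x); split=> //; first by rewrite size_rcons sS.
      by move=> y; rewrite mem_rcons inE => /orP[/eqP->|/hS1//]; exists i.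
    move=> k; rewrite ltnS leq_eqVlt => /orP[/eqP->|hk].
      by exists x => //; rewrite mem_rcons mem_head.
    by have [y yS hy] := hS _ hk; exists y => //; rewrite mem_rcons inE yS orbT.
  by rewrite h10'; nia.
by split=> //; exists [::]; split=> //; rewrite /get_seq h1.
Qed.

End Correctness.

Definition pk_cost (K Q0 : nat) : nat :=
  (K + 2) * (ccost (sum_prog K)).+1 + (K + 2) * (ccost (min_prog K)).+1 +
  ccost (grid_prog K) + 2 * ccost (header_prog Q0) +
  2 * (body_cost K + ccost (For 10 (eprod (fun=> G_expr) K) Skip)) + 4.

(** The conditions with Y bound what is stored in cells; intermediate values of expressions are
    covered by the degree D, and those inside the calls by d. *)
Lemma run_pk (K Q0 n : nat) (f0 : nat -> nat) (B Y D L : nat) (KP : cmd) (d T : nat)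
    (Good : ('I_n -> nat) -> {set 'I_n} -> Prop) (m : memory) :
  0 < K -> f0 3 = n -> 1 < Y -> Y ^ D <= B -> (Y ^ 2) ^ d <= B ->
  cdeg (pk_prog K Q0 KP) <= D ->
  (forall i, i < L -> vgrid (nN f0) i < nM K n f0) ->
  nM K n f0 <= vgrid (nN f0) L ->
  (forall pr, word_bound d (KP_input Q0 f0 pr) <= B ->
    exists t x, [/\ runs B KP (KP_input Q0 f0 pr) t (encode_solution x),
      t <= T & Good pr x]) ->
  (forall i, f0 i < Y) -> nS K n f0 < Y -> K.+1 * n < Y ->
  (forall i, i <= L -> vgrid (nN f0) i < Y) -> L < Y -> 4 + 2 * n < Y ->
  Q0 * nE f0 < Y ->
  (forall num den v, (forall k, k < K -> min_ratio n f0 num den (K * n) k) ->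
    (forall i, i <= L -> v i = vgrid (nN f0) i) ->
    forall i e, e < n -> nprofit K n f0 num den v L i e < Y) ->
  L.+1 ^ K < Y -> L.+1 ^ K * n < Y ->
  m 0 = f0 -> (forall a i, a != 0 -> m a i = 0) ->
  run B (pk_prog K Q0 KP) m (pk_cost K Q0 * (L.+1 ^ K * (n + T + 1)))
    (fun m' => exists num den v S, [/\
       forall k, k < K -> min_ratio n f0 num den (K * n) k,
       forall i, i <= L -> v i = vgrid (nN f0) i,
       output_of m' = flatten [seq encode_solution x | x : {set 'I_n} <- S],
       forall x, x \in S ->
         exists i, Good (fun e : 'I_n => nprofit K n f0 num den v L i e) x &
       forall i, i < L.+1 ^ K -> exists2 x, x \in S &
         Good (fun e : 'I_n => nprofit K n f0 num den v L i e) x]).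
Proof.
move=> K0 f0n Y1 YD Yd hD ltL geL KPs fY SY nY vY LY n4 QY pY GY GnY m0 mE.
have hb : bounded Y m.
  by move=> a i; have [->|na] := eqVneq a 0; [rewrite m0|rewrite mE //; lia].
have [D1 /cdeg_seq[D2 /cdeg_seq[D3 /cdeg_seq[D4 D5]]]] := cdeg_seq hD.
apply: (@run_weaken _ _ _ ((K.+1 * n).+1 * (ccost (sum_prog K)).+1 +
  ((K * n).+1 * (ccost (min_prog K)).+1 +
  (L.+1 * ccost (grid_prog K) + (n.+2 * ccost (header_prog Q0) +
   ((L.+1 ^ K).+1 * (body_cost K * (n + T + 1) +
       ccost (For 10 (eprod (fun=> G_expr) K) Skip)))).+1).+1).+1).+1 _ _ _ _ (fun _ => id)).
  (* As K is positive, the time for building the grid is absorbed by that for visiting its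
     points. *)
  have : L.+1 <= L.+1 ^ K by rewrite -{1}(expn1 L.+1) leq_pexp2l.
  rewrite /pk_cost.
  move: (ccost (sum_prog K)).+1 (ccost (min_prog K)).+1 (ccost (grid_prog K)) => c1 c2 c3.
  move: (ccost (header_prog Q0)) (body_cost K) (ccost (For _ _ _)) => c4 c5 c6.
  move: (L.+1 ^ K) => g hg; set x := n + T + 1.
  have x1 : 0 < x by lia.
  have xn : n < x by lia.
  have gx : x <= g * x by rewrite leq_pmull //; lia.
  have gx' : g <= g * x by rewrite leq_pmulr.
  have e5 : g.+1 * x <= 2 * (g * x) by nia.
  have e6 : g.+1 <= 2 * (g * x) by nia.
  have e7 : 0 < g * x by lia.
  move: (g * x) gx gx' e5 e6 e7 => z gx gx' e5 e6 e7.
  have e1 : (K.+1 * n).+1 <= (K + 2) * z by nia.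
  have e2 : (K * n).+1 <= (K + 2) * z by nia.
  have e3 : L.+1 <= z by lia.
  have e4 : n.+2 <= 2 * z by lia.
  have f1 := leq_mul e1 (leqnn c1); have f2 := leq_mul e2 (leqnn c2).
  have f3 := leq_mul e3 (leqnn c3); have f4 := leq_mul e4 (leqnn c4).
  have f5 := leq_mul e5 (leqnn c5); have f6 := leq_mul e6 (leqnn c6).
  by move: f1 f2 f3 f4 f5 f6 e7; clear; lia.
apply: run_seq; apply: run_weaken (leqnn _) _ (run_sum f0n Y1 YD m0 _ hb D1 SY nY); last exact: mE.
move=> m1 [s1 h15 b1].
have m10 : m1 0 = f0 by rewrite s1.
apply: run_seq; apply: run_weaken (leqnn _) _ (run_min f0n Y1 YD m10 _ b1 D2 _); first last.
- by lia.
- by move=> i; rewrite s1 // mE.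
move=> m2 [s2 b2 h2].
have m20 : m2 0 = f0 by rewrite s2.
have m25 : m2 5 0 = nS K n f0 by rewrite s2.
apply: run_seq; apply: run_weaken (leqnn _) _
  (run_grid (L := L) f0n Y1 YD ltL geL m20 m25 _ b2 D3 vY LY); last by rewrite s2 // s1 // mE.
move=> m3 [s3 b3 h39 h38].
have m30 : m3 0 = f0 by rewrite s3.
apply: run_seq; apply: run_weaken (leqnn _) _ (run_header f0n Y1 YD m30 b3 D4 n4 QY).
move=> m4 [s4 b4 h4].
have h3 k : k < K -> min_ratio n f0 (m2 6) (m2 7) (K * n) k by exact: h2.
have ok4 : arrays_ok K n f0 L (m2 6) (m2 7) (m3 8) m4.
  by rewrite /arrays_ok !s4 // h39 !(s3 6, s3 7, s3 5, s3 0).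
apply: run_weaken (leqnn _) _ (run_main f0n Y1 YD Yd KPs ok4 b4 _ _ D5 _ GY GnY).
- by move=> m5 [S [hS0 hS1 hS2]]; exists (m2 6), (m2 7), (m3 8), S; split.
- by move=> i; rewrite s4 // s3 // s2 // s1 // mE.
- exact: h4.
- exact: pY.
Qed.

Lemma size_flatten_rows (n : nat) (rows : seq ('I_n -> nat)) :
  size (flatten [seq codom r | r <- rows]) = size rows * n.
Proof.
by elim: rows => //= r rows IH; rewrite size_cat IH size_codom card_ord mulSn.
Qed.

Lemma nth_flatten_rows (n : nat) (rows : seq ('I_n -> nat)) (r : nat) (e : 'I_n) :
  r < size rows ->
  nth 0 (flatten [seq codom f | f <- rows]) (r * n + e) = nth (fun=> 0) rows r e.
Proof.
elim: rows r => //= f rows IH [_|r hr].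
  rewrite mul0n add0n nth_cat size_codom card_ord ltn_ord.
  by rewrite (nth_map e) ?size_enum_ord // nth_ord_enum.
rewrite nth_cat size_codom card_ord ifF; last by rewrite mulSn; lia.
by rewrite mulSn -addnA addKn IH.
Qed.

(** * The layout of the instance in the input array *)

Section Encoding.
Variables (K n : nat) (I : pknapsack K n) (p q : nat).

Definition pk_input : seq nat := [:: p, q & pk_encode I].
Definition pk_cells : nat -> nat := put_seq pk_input (fun=> 0).

Lemma size_pk_input : size pk_input = 4 + (K + 2) * n.
Proof.
rewrite -[LHS]/(size (flatten [seq codom r |
  r <- weight I :: base I :: [seq slope I k | k <- enum 'I_K]])).+4.
by rewrite size_flatten_rows /= size_map size_enum_ord addn2.
Qed.

Lemma cells_row (r : nat) (e : 'I_n) : r < K + 2 ->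
  pk_cells (5 + r * n + e) =
  nth (fun=> 0) (weight I :: base I :: [seq slope I k | k <- enum 'I_K]) r e.
Proof.
move=> hr; rewrite -nth_flatten_rows; last by rewrite /= size_map size_enum_ord; lia.
have hlt : r * n + e < (K + 2) * n by have := ltn_ord e; nia.
by rewrite -addnA.
Qed.

Lemma cells_weight (e : 'I_n) : weight I e = pk_cells (5 + e).
Proof. by have := @cells_row 0 e; rewrite mul0n addn0 => ->; rewrite ?addn2. Qed.

Lemma cells_base (e : 'I_n) : base I e = nbase n pk_cells e.
Proof. by have := @cells_row 1 e; rewrite mul1n /nbase => ->; rewrite ?addn2. Qed.

Lemma cells_slope (k : 'I_K) (e : 'I_n) : slope I k e = nslope n pk_cells k e.
Proof.
rewrite /nslope cells_row; last by rewrite ltn_add2r.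
rewrite addn2 /= (nth_map k) ?size_enum_ord //.
by rewrite nth_ord_enum.
Qed.

Lemma nSE : nS K n pk_cells =
  \sum_(e < n) base I e + \sum_(k < K) \sum_(e < n) slope I k e.
Proof.
have split_rows r (g : nat -> nat) :
    \sum_(i < r * n) g i = \sum_(j < r) \sum_(e < n) g (j * n + e).
  elim: r => [|r IHr]; first by rewrite mul0n !big_ord0.
  rewrite big_ord_recr /= -IHr -!(big_mkord xpredT g) mulSnr.
  rewrite (big_cat_nat (leq0n (r * n))) ?leq_addr //=; congr (_ + _).
  rewrite -{1}[r * n]add0n big_addn addKn big_mkord.
  by apply: eq_bigr => e _; rewrite addnC.
rewrite /nS (split_rows K.+1 (fun i => pk_cells (5 + n + i))) big_ord_recl /=; congr (_ + _).
  by apply: eq_bigr => e _; rewrite cells_base /nbase mul0n.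
apply: eq_bigr => k _; apply: eq_bigr => e _; rewrite cells_slope /nslope.
by congr pk_cells; rewrite /bump /=; ring.
Qed.

Lemma sum_base_le : \sum_(e < n) nbase n pk_cells e <= nS K n pk_cells.
Proof.
by rewrite nSE (eq_bigr _ (fun e _ => cells_base e)) leq_addr.
Qed.

Lemma sum_slope_le k : k < K ->
  \sum_(e < n) nslope n pk_cells k e <= nS K n pk_cells.
Proof.
move=> hk; rewrite nSE (bigD1 (Ordinal hk)) //= addnCA.
rewrite (eq_bigr _ (fun e _ => cells_slope (Ordinal hk) e)).
exact: leq_addr.
Qed.

Lemma nS_le_max : nS K n pk_cells <= K.+1 * n * max_component I.
Proof.
have hb e : base I e <= max_component I.
  by apply: leq_trans (leq_maxl _ _); exact: leq_bigmax.
have hs k e : slope I k e <= max_component I.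
  apply: leq_trans (leq_maxr _ _).
  apply: leq_trans (leq_bigmax (F := fun k => \max_e slope I k e) k).
  exact: leq_bigmax.
have hn (f : 'I_n -> nat) : (forall e, f e <= max_component I) ->
    \sum_(e < n) f e <= n * max_component I.
  move=> hf; rewrite -[X in X * _](card_ord n) -sum_nat_const.
  by apply: leq_sum => e _.
rewrite nSE -mulnA mulSn leq_add ?hn //.
rewrite -[X in X * _](card_ord K) -sum_nat_const.
by apply: leq_sum => k _; apply: hn.
Qed.

Lemma cells_lt i : pk_cells i + 2 <= 2 + size pk_input + \max_(v <- pk_input) v.
Proof.
rewrite addnC -addnA leq_add2l /pk_cells /put_seq.
have [lt|ge] := ltnP i (size pk_input).+1; last by rewrite nth_default.
case: i lt => [|i] lt; first exact: leq_addr.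
apply: leq_trans (leq_addl _ _); rewrite -[nth _ _ _]/(nth 0 pk_input i).
by apply: (leq_bigmax_seq (F := id)) => //; exact: mem_nth.
Qed.

End Encoding.

Local Open Scope ring_scope.

(** * Compression of weight vectors into a bounded cube *)

Section Compression.
Variables (R : realFieldType) (J : finType) (X : Type) (feas : X -> Prop).
Variables (F : X -> J -> nat) (U H h : R).
Hypothesis F_le : forall x j, feas x -> (F x j)%:R <= U.
Hypotheses (U_ge0 : 0 <= U) (h_gt0 : 0 < h) (H_ge1 : 1 <= H).
Hypothesis H_ge : #|J|%:R * U * h <= H.

Definition value (w : J -> R) (x : X) : R := \sum_j w j * (F x j)%:R.

Definition apx (rho : R) (w : J -> R) (x : X) : Prop :=
  forall y, feas y -> rho * value w y <= value w x.

Lemma apx_scale rho c w w' x : 0 < c -> (forall j, w' j = c * w j) ->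
  apx rho w x -> apx rho w' x.
Proof.
move=> c0 ww hx y hy; have vE z : value w' z = c * value w z.
  by rewrite mulr_sumr; apply: eq_bigr => j _; rewrite ww mulrA.
by rewrite !vE mulrCA ler_pM2l // hx.
Qed.

(* Heavy indices [A] and light ones differ by a factor of at least [H].  Then [w]
   is a convex combination of [w'] and of the restriction of [w'] to [A], and a
   good solution for [w'] is also good for that restriction, because [F] is
   integral and the light part is negligible against a nonzero heavy one. *)
Lemma apx_gap (A : pred J) (w w' : J -> R) (delta tau rho : R) (x : X) :
  0 < tau -> 0 <= delta <= 1 ->
  (forall j, A j -> tau <= w' j) ->
  (forall j, ~~ A j -> 0 <= w' j <= tau / H) ->
  (forall j, w j = if A j then w' j else delta * w' j) ->
  1 < h * rho -> feas x -> apx rho w' x -> apx (rho / (1 + h^-1)) w x.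
Proof.
move=> t0 /andP[d0 d1] hA hB hw hr fx hx y fy.
pose VA z := \sum_(j | A j) w' j * (F z j)%:R.
pose VB z := \sum_(j | ~~ A j) w' j * (F z j)%:R.
have H0 : 0 < H by apply: lt_le_trans H_ge1.
have v'E z : value w' z = VA z + VB z by rewrite /value (bigID A).
have vE z : value w z = VA z + delta * VB z.
  rewrite /value (bigID A) /= mulr_sumr; congr (_ + _); apply: eq_bigr => j hj.
    by rewrite hw hj.
  by rewrite hw (negbTE hj) mulrA.
have VB0 z : 0 <= VB z.
  by apply: sumr_ge0 => j /hB /andP[? _]; rewrite mulr_ge0.
(* Here the size of H is used: at most #|J| light terms, each at most U tau / H, sum up to at most
   tau / h. *)
have VBle z : feas z -> VB z <= tau / h.
  move=> fz; have : VB z <= \sum_(j : J) tau / H * U.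
    rewrite /VB big_mkcond; apply: ler_sum => j _; case: ifP => [/hB/andP[h1 h2]|_].
      by apply: ler_pM => //; exact: F_le.
    by rewrite mulr_ge0 // divr_ge0 // ltW.
  move=> /le_trans; apply; rewrite sumr_const -mulr_natl.
  have -> : #|J|%:R * (tau / H * U) = tau / h * (#|J|%:R * U * h / H).
    by field; rewrite !gt_eqF.
  by rewrite ler_piMr ?divr_ge0 ?(ltW t0) ?(ltW h_gt0) // ler_pdivrMr // mul1r.
have VA0 z : VA z = 0 \/ tau <= VA z.
  have [/existsP[j /andP[Aj nz]]|/existsPn h0] := boolP [exists j, A j && (F z j != 0%N)].
    right; rewrite /VA (bigD1 j) //= -[tau]addr0; apply: lerD.
      rewrite -[tau]mulr1; apply: ler_pM; rewrite ?(ltW t0) ?hA //.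
      by rewrite ler1n lt0n.
    apply: sumr_ge0 => i /andP[Ai _]; rewrite mulr_ge0 //.
    exact: le_trans (ltW t0) (hA _ Ai).
  left; rewrite /VA big1 // => j Aj; have := h0 j; rewrite Aj negbK => /eqP->.
  by rewrite mulr0.
have VAge0 z : 0 <= VA z by case: (VA0 z) => [->//|]; apply: le_trans; exact: ltW.
have hi0 : 0 < h^-1 by rewrite invr_gt0.
have r0 : 0 < rho by rewrite -(pmulr_rgt0 _ h_gt0); apply: lt_trans hr.
set g := 1 + h^-1; have g0 : 0 < g by rewrite /g; lra.
have hxy := hx y fy; rewrite !v'E in hxy.
have claim : rho * VA y <= g * VA x.
  have r1 : rho * VA y <= VA x + VB x.
    by apply: le_trans hxy; rewrite ler_pM2l // lerDl.
  have b1 := VBle x fx.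
  (* If the heavy part of x is 0, so is that of y: otherwise y would force x to have value at least
     rho tau, more than the tau / h its light part can supply. If it is nonzero, it is at least tau,
     and the light part is at most 1 / h of it. *)
  case: (VA0 x) => [x0|xt].
    case: (VA0 y) => [->|yt]; first by rewrite mulr0 mulr_ge0 // ltW.
    suff : rho * tau <= tau / h.
      rewrite mulrC ler_pM2l // -[leRHS]mulr1 ler_pdivlMl //.
      by rewrite leNgt hr.
    apply: le_trans (_ : rho * VA y <= _); first by rewrite ler_pM2l.
    by apply: le_trans r1 _; rewrite x0 add0r.
  rewrite /g mulrDl mul1r; apply: le_trans r1 _; rewrite lerD2l.
  by apply: le_trans b1 _; rewrite mulrC ler_pM2l.
rewrite !vE mulrAC ler_pdivrMr // mulrDr.
have p2 : rho * (VA y + VB y) <= g * (VA x + VB x).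
  apply: le_trans hxy _; rewrite ler_peMl ?addr_ge0 // /g; lra.
have -> : rho * VA y + rho * (delta * VB y) =
    delta * (rho * (VA y + VB y)) + (1 - delta) * (rho * VA y) by ring.
have -> : (VA x + delta * VB x) * g =
    delta * (g * (VA x + VB x)) + (1 - delta) * (g * VA x) by ring.
by apply: lerD; apply: ler_wpM2l => //; lra.
Qed.

Definition outliers (t : nat) (w : J -> R) : {set J} :=
  [set j | ~~ (H ^- t <= w j <= H ^+ t)].

Variable j0 : J.

(** When the window is widened from t to t + 1, either some outlier is caught, or every outlier is
    separated from the old window by a factor H. In the latter case a whole group of outliers can be
    rescaled until its innermost member reaches the boundary of the new window, at the price of one
    application of [apx_gap]. *)
Lemma compress_step (w : J -> R) (t m : nat) :
  (forall j, 0 <= w j) -> w j0 = 1 -> (#|outliers t w| <= m.+1)%N ->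
  exists w' : J -> R, [/\ forall j, 0 <= w' j, w' j0 = 1,
    (#|outliers t.+1 w'| <= m)%N &
    forall rho x, 1 < h * rho -> feas x -> apx rho w' x -> apx (rho / (1 + h^-1)) w x].
Proof.
move=> w0 wj0 hcard.
have H0 : 0 < H by apply: lt_le_trans H_ge1.
have Ht (s : nat) : 1 <= H ^+ s by rewrite exprn_ege1.
have Ht0 (s : nat) : 0 < H ^+ s by rewrite exprn_gt0.
have Hi0 (s : nat) : 0 < H ^- s by rewrite invr_gt0.
have Hi1 (s : nat) : H ^- s <= 1 by rewrite invf_le1.
have HtS : H ^+ t <= H ^+ t.+1 by rewrite exprS ler_peMl // ltW.
have HiS : H ^- t.+1 <= H ^- t by rewrite lef_pV2 ?posrE.
have weak : forall rho x, 1 < h * rho -> feas x -> apx rho w x -> apx (rho / (1 + h^-1)) w x.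
  move=> rho x hr fx hx y fy; apply: le_trans (hx y fy).
  have r0 : 0 < rho by rewrite -(pmulr_rgt0 _ h_gt0); apply: lt_trans hr.
  have hi0 : 0 < h^-1 by rewrite invr_gt0.
  apply: ler_wpM2r; first by apply: sumr_ge0 => j _; rewrite mulr_ge0.
  by rewrite ler_pdivrMr ?ler_peMr; lra.
have subout : outliers t.+1 w \subset outliers t w.
  apply/subsetP => j; rewrite !inE; apply: contra => /andP[a b].
  by rewrite (le_trans HiS a) (le_trans b HtS).
(* If rescaling moves an outlier [i] to the boundary of the larger window and
   creates no new outlier, the count drops. *)
have count w' i : i \in outliers t w -> H ^- t.+1 <= w' i <= H ^+ t.+1 ->
    (forall j, j \notin outliers t w -> w' j = w j) -> (#|outliers t.+1 w'| <= m)%N.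
  move=> iO hi hj; rewrite -ltnS; apply: leq_trans hcard.
  apply/proper_card/properP; split; last by exists i => //; rewrite inE negbK.
  apply/subsetP => j; apply: contraTT => jO; rewrite !inE negbK hj //.
  move: jO; rewrite !inE negbK => /andP[a b].
  by rewrite (le_trans HiS a) (le_trans b HtS).
have j0in : j0 \notin outliers t w by rewrite !inE negbK wj0 Hi1 Ht.
have [inw|/existsPn noin] := boolP [exists i, (i \in outliers t w) && (i \notin outliers t.+1 w)].
  exists w; split=> //; case/existsP: inw => i /andP[iO inO].
  by apply: (count w i) => //; move: inO; rewrite inE negbK.
pose A j := H ^+ t.+1 < w j.
have HH : H ^+ t.+1 / H = H ^+ t by rewrite exprS mulrC mulKf ?gt_eqF.
have HHi : H ^- t / H = H ^- t.+1 by rewrite exprS invfM mulrC.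
have in_or j : j \notin outliers t w \/ (w j < H ^- t.+1) \/ A j.
  case: (boolP (j \in outliers t w)) => hj; [right|by left].
  have := noin j; rewrite hj /= negbK inE negb_and -!ltNge => /orP[]; by [left|right].
have [/existsP[i1 Ai1]|/existsPn noA] := boolP [exists j, A j].
  (* The weights above the window are shrunk by a common factor that takes the smallest of them to
     H^(t+1). *)
  have [i Ai imin] := @arg_minP _ _ _ i1 A w Ai1.
  have wi0 : 0 < w i by apply: lt_trans Ai.
  pose s := H ^+ t.+1 / w i.
  have s0 : 0 < s by rewrite divr_gt0.
  have s1 : s <= 1 by rewrite ler_pdivrMr // mul1r ltW.
  pose w' j := if A j then s * w j else w j.
  exists w'; split=> //.
  - by move=> j; rewrite /w'; case: ifP => // _; rewrite mulr_ge0 // ltW.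
  - by rewrite /w' ifF // /A wj0; apply: negbTE; rewrite -leNgt.
  - apply: (count w' i).
    + rewrite inE negb_and -!ltNge orbC (le_lt_trans HtS) //.
    + by rewrite /w' Ai /s divfK ?gt_eqF // lexx andbT (le_trans (Hi1 _)).
    + move=> j; rewrite inE negbK /w' => /andP[_ hj]; rewrite ifF //.
      by apply: negbTE; rewrite -leNgt (le_trans hj).
  move=> rho x hr fx hx.
  (* Up to a common factor, shrinking the heavy weights is enlarging the light ones: s w agrees with
     w' on the heavy indices and is s w' on the others, as [apx_gap] requires with delta = s. *)
  apply: (@apx_scale _ s^-1 (fun j => s * w j)) => [|j|]; first by rewrite invr_gt0.
    by rewrite mulKf // gt_eqF.
  apply: (apx_gap (A := A) (w' := w') (delta := s) (tau := H ^+ t.+1)) => //.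
  - by rewrite (ltW s0).
  - move=> j Aj; rewrite /w' Aj -[leLHS](divfK (x := w i)) ?gt_eqF // -/s.
    by rewrite ler_pM2l // imin.
  - move=> j nAj; rewrite /w' (negbTE nAj) w0 HH /=.
    have [|[lt|]] := in_or j; [|exact: le_trans (ltW lt) (le_trans (Hi1 _) (Ht _))|by rewrite (negbTE nAj)].
    by rewrite inE negbK => /andP[].
  - by move=> j; rewrite /w'; case: (A j).
have [/existsP[i1 Oi1]|/existsPn noO] := boolP [exists j, j \in outliers t w]; last first.
  exists w; split=> //; rewrite (_ : outliers t.+1 w = set0) ?cards0 //.
  apply/eqP; rewrite -subset0; apply: subset_trans subout _.
  by apply/subsetP => j hj; have := noO j; rewrite hj.
pose L j := j \in outliers t w.
have Llt j : L j -> w j < H ^- t.+1.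
  by rewrite /L => hj; case: (in_or j) => [|[|hA]] //; [rewrite hj|have := noA j; rewrite hA].
have [i Li imax] := @arg_maxP _ _ _ i1 L w Oi1.
(* No factor moves a zero weight. If even the largest weight below the window is 0, all of them are
   set to H^-(t+1), which is the case delta = 0 of [apx_gap]. *)
have [wi0|wi0] := eqVneq (w i) 0.
  pose w' j := if L j then H ^- t.+1 else w j.
  exists w'; split=> //.
  - by move=> j; rewrite /w'; case: ifP => // _; exact: ltW.
  - by rewrite /w' ifF // /L; apply: negbTE.
  - apply: (count w' i) => //; rewrite /w' ?Li ?lexx ?(le_trans (Hi1 _)) //.
    by move=> j hj; rewrite ifF // /L; apply: negbTE.
  move=> rho x hr fx hx.
  apply: (apx_gap (A := predC L) (w' := w') (delta := 0) (tau := H ^- t)) => //.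
  - by rewrite lexx ler01.
  - move=> j /= nL; rewrite /w' (negbTE nL).
    by move: nL; rewrite /L inE negbK => /andP[].
  - by move=> j /=; rewrite negbK => Lj; rewrite /w' Lj HHi lexx (ltW (Hi0 _)).
  - move=> j /=; rewrite /w'; case Lj: (L j) => //=; rewrite mul0r.
    by apply: le_anti; rewrite w0 andbT -wi0; exact: imax.
have wi1 : 0 < w i by rewrite lt_neqAle eq_sym wi0 w0.
pose s := H ^- t.+1 / w i.
have s0 : 0 < s by rewrite divr_gt0.
have s1 : 1 <= s by rewrite ler_pdivlMr // mul1r ltW // Llt.
pose w' j := if L j then s * w j else w j.
exists w'; split=> //.
- by move=> j; rewrite /w'; case: ifP => // _; rewrite mulr_ge0 // ltW.
- by rewrite /w' ifF // /L; apply: negbTE.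
- apply: (count w' i) => //.
    by rewrite /w' Li /s divfK ?gt_eqF // lexx (le_trans (Hi1 _)).
  by move=> j hj; rewrite /w' ifF // /L; apply: negbTE.
move=> rho x hr fx hx.
apply: (apx_gap (A := predC L) (w' := w') (delta := s^-1) (tau := H ^- t)) => //.
- by rewrite invr_ge0 (ltW s0) invf_le1.
- move=> j /= nL; rewrite /w' (negbTE nL).
  by move: nL; rewrite /L inE negbK => /andP[].
- move=> j /=; rewrite negbK => Lj; rewrite /w' Lj HHi mulr_ge0 ?(ltW s0) //=.
  rewrite -[leRHS](divfK (x := w i)) ?gt_eqF // -/s.
  by rewrite ler_pM2l //; exact: imax.
- by move=> j /=; rewrite /w'; case: (L j) => //=; rewrite mulKf ?gt_eqF.
Qed.

Lemma compress_iter (m t : nat) (w : J -> R) :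
  (forall j, 0 <= w j) -> w j0 = 1 -> (#|outliers t w| <= m)%N ->
  exists w' : J -> R, [/\ w' j0 = 1, forall j, H ^- (t + m) <= w' j <= H ^+ (t + m) &
    forall rho x, 1 < h * (rho / (1 + h^-1) ^+ m) -> feas x -> apx rho w' x ->
      apx (rho / (1 + h^-1) ^+ m) w x].
Proof.
have g1 : 1 <= 1 + h^-1 by rewrite lerDl invr_ge0 ltW.
have g0 : 0 < 1 + h^-1 by exact: lt_le_trans g1.
elim: m t w => [|m IHm] t w w0 wj0 hcard.
  exists w; split=> // [j|rho x _ _]; last by rewrite expr0 divr1.
  move: hcard; rewrite leqn0 cards_eq0 => /eqP O0; rewrite addn0.
  by have := in_set0 j; rewrite -O0 inE => /negbFE.
have [w1 [w10 w1j0 hcard1 h1]] := compress_step w0 wj0 hcard.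
have [w' [w'j0 hw' h2]] := IHm _ _ w10 w1j0 hcard1.
exists w'; split=> //; first by move=> j; rewrite -addSnnS.
move=> rho x hr fx hx.
have r0 : 0 < rho.
  have /(lt_trans ltr01) := hr; rewrite pmulr_rgt0 // pmulr_lgt0 //.
  by rewrite invr_gt0 exprn_gt0.
have e : rho / (1 + h^-1) ^+ m.+1 = rho / (1 + h^-1) ^+ m / (1 + h^-1).
  by rewrite exprSr invfM mulrA.
have hr' : 1 < h * (rho / (1 + h^-1) ^+ m).
  apply: lt_le_trans hr _; rewrite ler_pM2l // e ler_pdivrMr // ler_peMr //.
  by rewrite divr_ge0 ?exprn_ge0 // ltW.
by rewrite e; apply: h1 => //; exact: h2.
Qed.

Lemma compression (w : J -> R) : (forall j, 0 <= w j) -> w j0 = 1 ->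
  exists w' : J -> R, [/\ w' j0 = 1,
    forall j, H ^- #|J|.-1 <= w' j <= H ^+ #|J|.-1 &
    forall rho x, 1 < h * (rho / (1 + h^-1) ^+ #|J|.-1) -> feas x -> apx rho w' x ->
      apx (rho / (1 + h^-1) ^+ #|J|.-1) w x].
Proof.
move=> w0 wj0; apply: (@compress_iter _ 0) => //.
(* For t = 0 the window is the single point 1, which is the weight at [j0]; so there are at most
   #|J| - 1 outliers. *)
rewrite -(cardsC1 j0); apply: subset_leq_card; apply/subsetP => j.
by rewrite !inE; apply: contraNneq => ->; rewrite wj0 expr0 invr1 lexx.
Qed.

End Compression.

(** * The integer geometric grid: growth, length, covering, indexing by digits *)

Lemma vgrid_geN N i : (N <= vgrid N i)%N.
Proof. by elim: i => //= i /leq_trans; apply; exact: leq_addr. Qed.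

Lemma vgrid_mono N i j : (i <= j)%N -> (vgrid N i <= vgrid N j)%N.
Proof.
elim: j => [|j IHj]; first by rewrite leqn0 => /eqP->.
by rewrite leq_eqVlt => /orP[/eqP->//|/IHj/leq_trans]; apply; exact: leq_addr.
Qed.

Lemma vgrid_ge_add N i k : (vgrid N i + k * (vgrid N i %/ N) <= vgrid N (i + k))%N.
Proof.
elim: k => [|k IHk]; first by rewrite mul0n !addn0.
rewrite addnS /= mulSn addnCA addnC; apply: leq_add => //.
by apply: leq_div2r; apply: vgrid_mono; exact: leq_addr.
Qed.

(** For v >= N, rounding v / N down loses less than half of it, so 2 N steps, each at least as long
    as the first one, add up to v. *)
Lemma vgrid_double N i : (0 < N)%N -> (2 * vgrid N i <= vgrid N (i + 2 * N))%N.
Proof.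
move=> N0; apply: leq_trans (vgrid_ge_add N i (2 * N)).
have := divn_eq (vgrid N i) N; have := ltn_pmod (vgrid N i) N0.
have : (0 < vgrid N i %/ N)%N by rewrite divn_gt0 // vgrid_geN.
by move: (_ %/ _)%N (_ %% _)%N => a b; nia.
Qed.

Lemma vgrid_exp N s : (0 < N)%N -> (2 ^ s * N <= vgrid N (2 * N * s))%N.
Proof.
move=> N0; elim: s => [|s IHs]; first by rewrite muln0 mul1n.
rewrite mulnS addnC expnS -mulnA; apply: leq_trans (vgrid_double _ N0).
by rewrite leq_mul2l.
Qed.

Lemma vgrid_lt N i : (0 < N)%N -> (vgrid N i < vgrid N i.+1)%N.
Proof. by move=> N0; rewrite /= -[X in (X < _)%N]addn0 ltn_add2l divn_gt0 // vgrid_geN. Qed.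

Lemma vgrid_gei N i : (0 < N)%N -> (i <= vgrid N i)%N.
Proof. by move=> N0; elim: i => // i IHi; apply: leq_ltn_trans IHi (vgrid_lt i N0). Qed.

Lemma vgrid_length N M s : (0 < N)%N -> (M <= 2 ^ s * N)%N ->
  exists L, [/\ forall i, (i < L)%N -> (vgrid N i < M)%N, (M <= vgrid N L)%N
    & (L <= 2 * N * s)%N].
Proof.
move=> N0 hM.
have ex : exists i, (M <= vgrid N i)%N.
  by exists (2 * N * s)%N; exact: leq_trans hM (vgrid_exp s N0).
exists (ex_minn ex); case: ex_minnP => L hL Lmin; split=> //.
  by move=> i; apply: contraTltn => /Lmin; rewrite leqNgt.
by apply: Lmin; exact: leq_trans hM (vgrid_exp s N0).
Qed.

Lemma vgrid_cover (R : realFieldType) N L (w : R) : (0 < N)%N ->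
  N%:R <= w <= (vgrid N L)%:R ->
  exists i, [/\ (i <= L)%N, (vgrid N i)%:R <= w &
    w <= (1 + N%:R^-1) * (vgrid N i)%:R].
Proof.
move=> N0; have N0' : 0 < N%:R :> R by rewrite ltr0n.
elim: L => [|L IHL] /andP[h1 h2].
  exists 0%N; split=> //; apply: le_trans h2 _; rewrite ler_peMl ?ler0n //.
  by rewrite lerDl invr_ge0 ltW.
have [le|/ltW lt] := leP w (vgrid N L)%:R.
  by have [|i [hi a b]] := IHL; [rewrite h1 le|exists i; split=> //; exact: leqW].
exists L; split=> //; apply: le_trans h2 _.
rewrite /= natrD mulrDl mul1r lerD2l ler_pdivlMl // -natrM ler_nat mulnC.
exact: leq_trunc_div.
Qed.

Lemma digits_exist (K L : nat) (idx : nat -> nat) : (forall k, (idx k <= L)%N) ->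
  exists i, (i < L.+1 ^ K)%N /\
    forall k, (k < K)%N -> (i %/ L.+1 ^ k %% L.+1 = idx k)%N.
Proof.
move=> hidx; elim: K => [|K [i [hi hk]]]; first by exists 0%N.
have p0 : (0 < L.+1 ^ K)%N by rewrite expn_gt0.
exists (idx K * L.+1 ^ K + i)%N; split.
  rewrite expnS; apply: (@leq_trans ((idx K).+1 * L.+1 ^ K)).
    by rewrite mulSn addnC ltn_add2r.
  by rewrite leq_mul2r ltnS hidx orbT.
move=> k; rewrite ltnS leq_eqVlt => /orP[/eqP->|kK].
  by rewrite divnMDl // divn_small // addn0 modn_small // ltnS.
rewrite -(subnKC (ltnW kK)) expnD mulnA mulnAC divnMDl ?expn_gt0 //.
have -> : (K - k = (K - k).-1.+1)%N by rewrite prednK // subn_gt0.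
by rewrite expnS mulnA mulnAC modnMDl hk.
Qed.

(** Turns the loss (1 + 1/h)^K of the compression into 1 / (1 - K/h), without exponentials. *)
Lemma expr1D_mul_le1 (R : realFieldType) (y : R) (k : nat) : 0 <= y ->
  (1 + y) ^+ k * (1 - k%:R * y) <= 1.
Proof.
move=> y0; elim: k => [|k IHk]; first by rewrite expr0; lra.
apply: le_trans IHk; rewrite exprSr -mulrA ler_wpM2l ?exprn_ge0 //; first lra.
by rewrite -natr1; have : 0 <= k%:R :> R by []; nra.
Qed.

Lemma row_lt (K n k e : nat) : (k < K)%N -> (e < n)%N -> (k * n + e < K * n)%N.
Proof. by move=> kK en; nia. Qed.

(** * Solutions at the grid points form an approximation set *)

Section Approximation.
Variables (R : realType) (K n Q0 L : nat) (I : pknapsack K n) (f0 num den v : nat -> nat).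
Hypotheses (K_gt0 : (0 < K)%N) (Q0_ge8 : (8 <= Q0)%N).
Hypothesis base_eq : forall e : 'I_n, base I e = nbase n f0 e.
Hypothesis slope_eq : forall (k : 'I_K) (e : 'I_n), slope I k e = nslope n f0 k e.
Hypothesis budget_eq : budget I = f0 4%N.
Hypothesis weight_eq : forall e : 'I_n, weight I e = f0 (5 + e)%N.
Hypothesis min_num_den : forall k, (k < K)%N -> min_ratio n f0 num den (K * n) k.
Hypothesis v_grid : forall i, (i <= L)%N -> v i = vgrid (nN f0) i.
Hypothesis L_ge : (nM K n f0 <= vgrid (nN f0) L)%N.
Hypothesis base_le : (\sum_(e < n) nbase n f0 e <= nS K n f0)%N.
Hypothesis slope_le :
  forall k, (k < K)%N -> (\sum_(e < n) nslope n f0 k e <= nS K n f0)%N.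

Lemma slope_max (k e : nat) : (k < K)%N -> (e < n)%N ->
  (num k * nslope n f0 k e <= nbase n f0 e * den k)%N.
Proof. by move=> kK en; have [_ _] := min_num_den kK; apply=> //; exact: row_lt. Qed.

Lemma den_gt0 (k : 'I_K) : (0 < den k)%N.
Proof.
have [A1 _ _] := min_num_den (ltn_ord k); rewrite lt0n; apply/eqP => d0.
have [e /eqP[]] := slope_neq0 I k.
by rewrite slope_eq A1 // row_lt.
Qed.

Lemma den_item (k : 'I_K) : exists e : 'I_n,
  num k = base I e /\ den k = slope I k e.
Proof.
have [_ A2 _] := min_num_den (ltn_ord k).
have [e [en h1 h2]] := A2 (elimN eqP (lt0n_neq0 (den_gt0 k))).
by exists (Ordinal en); rewrite base_eq slope_eq.
Qed.

Lemma den_le (k : 'I_K) : (den k <= nS K n f0)%N.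
Proof.
have [e [_ ->]] := den_item k; apply: leq_trans (slope_le (ltn_ord k)).
by rewrite slope_eq (bigD1 e) //= leq_addr.
Qed.

Lemma nS_gt0 : (0 < nS K n f0)%N.
Proof. exact: leq_trans (den_gt0 (Ordinal K_gt0)) (den_le _). Qed.

Definition den_prod : nat := (\prod_(k < K) den k)%N.

Lemma den_prod_gt0 : (0 < den_prod)%N.
Proof. by rewrite /den_prod prodn_gt0 // => k; exact: den_gt0. Qed.

Lemma den_dvd (k : 'I_K) : (den k %| den_prod)%N.
Proof. by rewrite /den_prod (bigD1 k) //= dvdn_mulr. Qed.

Lemma den_prod_le : (den_prod <= nS K n f0 ^ K)%N.
Proof.
rewrite -[X in (_ ^ X)%N](card_ord K) -prod_nat_const.
by apply: leq_prod => k _; exact: den_le.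
Qed.

Lemma nF0_le (e : nat) : (nF0 K n f0 num den e <= K * nS K n f0 ^ K * nbase n f0 e)%N.
Proof.
apply: (@leq_trans (\sum_(k < K) nS K n f0 ^ K * nbase n f0 e)); last first.
  by rewrite sum_nat_const card_ord mulnA.
apply: leq_sum => k _; rewrite -/den_prod.
apply: (@leq_trans (den_prod %/ den k * (den k * nbase n f0 e))).
  by rewrite leq_mul2l leq_subr orbT.
by rewrite mulnA divnK ?den_dvd // leq_mul2r den_prod_le orbT.
Qed.

(** Index [ord0] carries the scaled profit at the corner of the parameter set, whose weight is the
    fixed one; the index [lift ord0 k] carries the coefficient of the k-th parameter. *)
Definition component (x : {set 'I_n}) (j : 'I_K.+1) : nat :=
  (if unlift ord0 j is Some k then \sum_(e in x) slope I k e
  else \sum_(e in x) nF0 K n f0 num den e)%N.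

Lemma component0E x : component x ord0 = (\sum_(e in x) nF0 K n f0 num den e)%N.
Proof. by rewrite /component unlift_none. Qed.

Lemma component_liftE x k : component x (lift ord0 k) = (\sum_(e in x) slope I k e)%N.
Proof. by rewrite /component liftK. Qed.

Lemma component_le x j : (component x j <= K * nS K n f0 ^ K.+1)%N.
Proof.
rewrite /component; case: (unlift ord0 j) => [k|].
  apply: (@leq_trans (nS K n f0)).
    apply: leq_trans (slope_le (ltn_ord k)).
    rewrite [leqRHS](bigID (mem x)) /=; apply: leq_trans (leq_addr _ _).
    by rewrite (eq_bigr (fun e : 'I_n => nslope n f0 k e)) // => e _; rewrite slope_eq.
  rewrite expnS mulnCA leq_pmulr // muln_gt0 K_gt0 expn_gt0 nS_gt0 //.
apply: (@leq_trans (\sum_(e < n) K * nS K n f0 ^ K * nbase n f0 e)%N).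
  rewrite [leqRHS](bigID (mem x)) /=; apply: leq_trans (leq_addr _ _).
  by apply: leq_sum => e _; exact: nF0_le.
by rewrite -big_distrr /= expnSr mulnA leq_mul2l base_le orbT.
Qed.

Lemma valueE (w : 'I_K.+1 -> R) x : value component w x =
  w ord0 * (component x ord0)%:R + \sum_(k < K) w (lift ord0 k) * (component x (lift ord0 k))%:R.
Proof. by rewrite /value big_ord_recl. Qed.

(* [lambda] relative to the corner of the parameter set, times [K * den_prod]: in
   these coordinates all weights and all profit components are nonnegative, and the
   latter are integers. *)
Definition scaled_weight (lambda : 'I_K -> R) (j : 'I_K.+1) : R :=
  if unlift ord0 j is Some k
  then K%:R * den_prod%:R * (lambda k + (num k)%:R / (K%:R * (den k)%:R)) else 1.

Lemma scaled_weight_ge0 lambda j : param_set I lambda -> 0 <= scaled_weight lambda j.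
Proof.
move=> hl; rewrite /scaled_weight; case: (unlift ord0 j) => [k|] //.
rewrite !mulr_ge0 //; have [e [h1 h2]] := den_item k.
(* The minimal ratio is attained by an item with nonzero slope, so its breakpoint is among those
   whose maximum is [lambda_min]. *)
have h : breakpoint R I k e <= lambda k.
  apply: le_trans (hl k); apply: le_bigmax_cond.
  by rewrite -h2 -lt0n den_gt0.
by move: h; rewrite /breakpoint -h1 -h2; lra.
Qed.

Lemma nF0_real (e : 'I_n) : (nF0 K n f0 num den e)%:R =
  \sum_(k < K) (den_prod%:R * (base I e)%:R
     - den_prod%:R * (num k)%:R / (den k)%:R * (slope I k e)%:R) :> R.
Proof.
rewrite /nF0 natr_sum; apply: eq_bigr => k _; rewrite -/den_prod.
have d0 : (den k)%:R != 0 :> R by rewrite pnatr_eq0 -lt0n den_gt0.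
(* Minimality of the ratio makes the truncated subtraction exact. *)
rewrite natrM natrB; last first.
  by rewrite [(den k * _)%N]mulnC slope_max.
have -> : (den_prod %/ den k)%:R = den_prod%:R / (den k)%:R :> R.
  by apply: (canRL (mulfK d0)); rewrite -natrM divnK ?den_dvd.
by rewrite !natrM base_eq slope_eq; field.
Qed.

(** The base profit of an item is split into K equal shares, one per parameter. Moving lambda_k to
    the corner subtracts from its share exactly what the minimal ratio of row k allows; this is the
    origin of the factor K in [breakpoint]. *)
Lemma profit_value lambda x :
  value component (scaled_weight lambda) x = K%:R * den_prod%:R * pk_profit I x lambda.
Proof.
have K0 : K%:R != 0 :> R by rewrite pnatr_eq0 -lt0n.
rewrite valueE component0E natr_sum {1}/scaled_weight unlift_none mul1r.
under eq_bigr => e _ do rewrite nF0_real.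
have -> : \sum_(k < K) scaled_weight lambda (lift ord0 k) * (component x (lift ord0 k))%:R =
   \sum_(e in x) \sum_(k < K) scaled_weight lambda (lift ord0 k) * (slope I k e)%:R.
  rewrite exchange_big; apply: eq_bigr => k _.
  by rewrite component_liftE natr_sum mulr_sumr.
rewrite -big_split /= /pk_profit mulr_sumr; apply: eq_bigr => e _.
rewrite -big_split /=.
have -> : (base I e)%:R + \sum_k lambda k * (slope I k e)%:R =
    \sum_(k < K) ((base I e)%:R / K%:R + lambda k * (slope I k e)%:R).
  rewrite big_split /= sumr_const card_ord -[X in _ = X + _]mulr_natr.
  by rewrite divfK.
rewrite mulr_sumr; apply: eq_bigr => k _; rewrite /scaled_weight liftK.
have d0 : (den k)%:R != 0 :> R by rewrite pnatr_eq0 -lt0n den_gt0.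
by field; rewrite K0 d0.
Qed.

Lemma grid_value i x (u : 'I_K.+1 -> R) :
  u ord0 = (nZ K n f0)%:R ->
  (forall k : 'I_K, u (lift ord0 k) = (v (i %/ L.+1 ^ k %% L.+1))%:R) ->
  value component u x = (\sum_(e in x) nprofit K n f0 num den v L i e)%N%:R.
Proof.
move=> u0 uk; rewrite valueE u0 component0E natr_sum mulr_sumr natr_sum.
under [X in _ + X]eq_bigr => k _ do rewrite uk component_liftE natr_sum mulr_sumr.
rewrite exchange_big -big_split /=; apply: eq_bigr => e _.
rewrite /nprofit natrD natrM; congr (_ + _).
by rewrite natr_sum; apply: eq_bigr => k _; rewrite natrM slope_eq.
Qed.

Definition good_solution (q : nat) (pr : 'I_n -> nat) (x : {set 'I_n}) : Prop :=
  feasible (f0 4) (fun e : 'I_n => f0 (5 + e)%N) x /\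
  forall x', feasible (f0 4) (fun e : 'I_n => f0 (5 + e)%N) x' ->
    (1 - q%:R^-1) * (\sum_(e in x') pr e)%N%:R <= (\sum_(e in x) pr e)%N%:R :> R.

Lemma feasible_eq x :
  pk_feasible I x = feasible (f0 4) (fun e : 'I_n => f0 (5 + e)%N) x.
Proof.
rewrite /pk_feasible /feasible budget_eq; congr (_ <= _)%N.
by apply: eq_bigr => e _; exact: weight_eq.
Qed.

Lemma approximation_of_grid (eps : R) (S : seq {set 'I_n}) :
  (nE f0)%:R^-1 <= eps ->
  (forall x, x \in S -> exists i, good_solution (Q0 * nE f0)
      (fun e => nprofit K n f0 num den v L i e) x) ->
  (forall i, (i < L.+1 ^ K)%N -> exists2 x, x \in S &
     good_solution (Q0 * nE f0) (fun e => nprofit K n f0 num den v L i e) x) ->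
  approximation_set I (1 + eps) S.
Proof.
move=> heps hS1 hS; split.
  by move=> x /hS1[i [hx _]]; rewrite feasible_eq.
move=> lambda hl; pose w := scaled_weight lambda.
have E0 : (0 < nE f0)%N by rewrite /nE addn1.
have S0 := nS_gt0.
pose U : R := (K * nS K n f0 ^ K.+1)%:R; pose H : R := (nH K n f0)%:R.
(* Chosen such that K / h = 1 / (8 E), the share of the error granted to the compression; [nH] is
   precisely (K + 1) U h. *)
pose h : R := (8 * K * nE f0)%:R.
have H0 : (0 < nH K n f0)%N by rewrite /nH !muln_gt0 K_gt0 E0 expn_gt0 S0.
have h0 : 0 < h by rewrite ltr0n !muln_gt0 K_gt0.
have hH : #|{: 'I_K.+1}|%:R * U * h <= H.
  by rewrite card_ord -!natrM ler_nat; apply: eq_leq; rewrite /nH; ring.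
have H1 : 1 <= H by rewrite ler1n.
have FU (x : {set 'I_n}) (j : 'I_K.+1) (_ : pk_feasible I x) : (component x j)%:R <= U.
  by rewrite ler_nat component_le.
have w0 : w ord0 = 1 by rewrite /w /scaled_weight unlift_none.
have [w' [w'0 w'b w'apx]] := compression FU (ler0n _ _) h0 H1 hH
  (fun j => scaled_weight_ge0 j hl) w0.
rewrite card_ord /= in w'b w'apx.
have N0 : (0 < nN f0)%N by rewrite /nN muln_gt0.
pose N : R := (nN f0)%:R; pose Z : R := (nZ K n f0)%:R.
have ZE : Z = N * H ^+ K by rewrite /Z /nZ natrM natrX.
have ME : (nM K n f0)%:R = Z * H ^+ K :> R.
  by rewrite /nM natrM natrX mul2n -addnn exprD mulrA -ZE.
have HK0 : 0 < H ^+ K by rewrite exprn_gt0 // ltr0n.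
have N0' : 0 < N by rewrite ltr0n.
have Z0 : 0 < Z by rewrite ZE mulr_gt0.
(* Multiplication by Z = N H^K takes the interval from H^-K to H^K to the one from N to [nM], which
   the grid covers. *)
have cover (k : 'I_K) : exists i, [/\ (i <= L)%N, (vgrid (nN f0) i)%:R <= Z * w' (lift ord0 k) &
    Z * w' (lift ord0 k) <= (1 + N^-1) * (vgrid (nN f0) i)%:R].
  apply: vgrid_cover => //; have /andP[b1 b2] := w'b (lift ord0 k).
  apply/andP; split.
    by rewrite ZE -mulrA ler_peMr ?(ltW N0') // mulrC -ler_pdivrMr // div1r.
  apply: le_trans (_ : (nM K n f0)%:R <= _); last by rewrite ler_nat.
  by rewrite ME ler_pM2l.
have [idx hidx] := fin_all_exists cover.
pose idx' k := if insub k is Some o then idx o else 0%N.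
have idx'E (k : 'I_K) : idx' k = idx k by rewrite /idx' valK.
have idxL k : (idx' k <= L)%N.
  by rewrite /idx'; case: insub => [o|//]; case: (hidx o).
have [i [iK hi]] := digits_exist K idxL.
have [x xS [xf hx]] := hS i iK.
exists x => //; rewrite -feasible_eq in xf.
pose u (j : 'I_K.+1) : R := if unlift ord0 j is Some k
  then (v (i %/ L.+1 ^ k %% L.+1))%:R else Z.
have u0 : u ord0 = Z by rewrite /u unlift_none.
have uk (k : 'I_K) : u (lift ord0 k) = (v (i %/ L.+1 ^ k %% L.+1))%:R by rewrite /u liftK.
have uk' (k : 'I_K) : u (lift ord0 k) = (vgrid (nN f0) (idx k))%:R.
  by rewrite uk (hi _ (ltn_ord k)) idx'E v_grid //; case: (hidx k).
have ubound (j : 'I_K.+1) : u j <= Z * w' j <= (1 + N^-1) * u j.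
  case: (unliftP ord0 j) => [k ->|->].
    by rewrite uk'; case: (hidx k) => _ -> ->.
  by rewrite u0 w'0 mulr1 lexx ler_peMl ?(ltW Z0) // lerDl invr_ge0 ltW.
pose rho0 : R := 1 - (Q0 * nE f0)%:R^-1.
have apx_u : apx (fun x => pk_feasible I x) component rho0 u x.
  move=> y; rewrite feasible_eq => fy.
  by rewrite (grid_value (i := i)) // (grid_value (i := i)) //; exact: hx.
pose y : R := (8 * nE f0)%:R^-1.
have E1 : 1 <= (nE f0)%:R :> R by rewrite ler1n.
have yE : y = (nE f0)%:R^-1 / 8 by rewrite /y natrM invfM mulrC.
have Ei : 0 < (nE f0)%:R^-1 :> R by rewrite invr_gt0; lra.
have Ei1 : (nE f0)%:R^-1 <= 1 :> R by rewrite invf_le1 //; lra.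
have NE : N^-1 = y by [].
have y0 : 0 < y by rewrite yE; lra.
have Ky : K%:R * h^-1 = y.
  rewrite /h /y [(8 * K)%N]mulnC -mulnA natrM invfM mulrA divff ?mul1r //.
  by rewrite pnatr_eq0 -lt0n.
have rho0_ge : 1 - y <= rho0.
  rewrite lerD2l lerN2 lef_pV2 ?posrE ?ltr0n ?muln_gt0 ?E0 ?andbT //.
    by rewrite ler_nat leq_mul2r Q0_ge8 orbT.
  exact: leq_trans Q0_ge8.
have Fv_ge0 (z : {set 'I_n}) (w1 : 'I_K.+1 -> R) : (forall j, 0 <= w1 j) -> 0 <= value component w1 z.
  by move=> h1; apply: sumr_ge0 => j _; rewrite mulr_ge0.
have rho0_0 : 0 < rho0 by rewrite (lt_le_trans _ rho0_ge) //; lra.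
have apx_w' : apx (fun x => pk_feasible I x) component (rho0 / (1 + N^-1)) w' x.
  apply: (@apx_scale _ _ _ _ _ _ Z^-1 (fun j => Z * w' j)) => [|j|].
  - by rewrite invr_gt0.
  - by rewrite mulKf // gt_eqF.
  move=> z fz; apply: (@le_trans _ _ (value component u x)); last first.
    by apply: ler_sum => j _; apply: ler_wpM2r => //; case/andP: (ubound j).
  apply: le_trans (apx_u z fz); rewrite -mulrA ler_wpM2l ?(ltW rho0_0) //.
  rewrite mulrC ler_pdivrMr; last by rewrite NE; lra.
  rewrite mulrC /value mulr_sumr; apply: ler_sum => j _.
  by rewrite mulrA ler_wpM2r //; case/andP: (ubound j).
pose g : R := rho0 / (1 + N^-1) / (1 + h^-1) ^+ K.
have g_ge : (1 + (nE f0)%:R^-1)^-1 <= g.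
  have hK0 : 0 < (1 + h^-1) ^+ K by rewrite exprn_gt0 // addr_gt0 // invr_gt0.
  have := expr1D_mul_le1 K (ltW (_ : 0 < h^-1)); rewrite invr_gt0 Ky => /(_ h0) b1.
  have {}b1 : (1 + h^-1) ^+ K <= (1 - y)^-1.
    by rewrite -[leRHS]div1r ler_pdivlMr //; lra.
  rewrite /g NE -[leLHS]div1r ler_pdivrMr; last by lra.
  rewrite mulrAC ler_pdivlMr // mul1r mulrAC ler_pdivlMr; last by lra.
  apply: le_trans (_ : (1 - y)^-1 * (1 + y) <= _).
    by rewrite ler_wpM2r //; lra.
  rewrite mulrC ler_pdivrMr; last by lra.
  (* The error budget: 1 + y <= (1 - y)^2 (1 + 8 y) for 0 <= y <= 1/8, where 8 y = 1/E. One factor 1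
     - y stands for the compression, the other for the knapsack accuracy, and 1 + y for the grid. *)
  apply: le_trans (_ : (1 - y) * (1 + 8 * y) * (1 - y) <= _); first by rewrite yE; nra.
  rewrite ler_wpM2r; [by []|lra|].
  by rewrite (_ : 8 * y = (nE f0)%:R^-1) ?ler_wpM2r //; [lra|rewrite yE; lra].
have hg : 1 < h * g.
  apply: lt_le_trans (_ : h * (1 + (nE f0)%:R^-1)^-1 <= _); last by rewrite ler_pM2l.
  rewrite ltr_pdivlMr ?mul1r; last by lra.
  have : 8 <= h by rewrite ler_nat -mulnA leq_pmulr // muln_gt0 K_gt0.
  by lra.
have apx_w := w'apx _ _ hg xf apx_w'.
move=> z fz; have KP0 : 0 < K%:R * den_prod%:R :> R by rewrite -natrM ltr0n muln_gt0 K_gt0 den_prod_gt0.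
rewrite -(ler_pM2l KP0) mulrCA -!profit_value.
apply: le_trans (apx_w z fz); apply: ler_wpM2r.
  by apply: Fv_ge0 => j; exact: scaled_weight_ge0.
apply: le_trans g_ge; rewrite lef_pV2 ?posrE ?lerD2l //; lra.
Qed.

End Approximation.

(** * All stored numbers are bounded by a fixed power of the input parameters *)

Section WordBound.
Local Open Scope nat_scope.

Lemma leq_expX (X c : nat) : 1 < X -> c <= X ^ c.
Proof. by move=> X1; exact/ltnW/ltn_expl. Qed.

Lemma leq_addX (X a b x y : nat) : 1 < X -> x <= X ^ a -> y <= X ^ b ->
  x + y <= X ^ (a + b + 1).
Proof.
move=> X1 hx hy; rewrite addn1 expnS.
have X0 : 0 < X by exact: ltnW.
have ha : X ^ a <= X ^ (a + b) by rewrite leq_pexp2l // leq_addr.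
have hb : X ^ b <= X ^ (a + b) by rewrite leq_pexp2l // leq_addl.
by nia.
Qed.

Lemma leq_mulX (X a b x y : nat) : x <= X ^ a -> y <= X ^ b -> x * y <= X ^ (a + b).
Proof. by move=> hx hy; rewrite expnD leq_mul. Qed.

Lemma leq_powX (X a k x : nat) : x <= X ^ a -> x ^ k <= X ^ (a * k).
Proof.
by move=> hx; case: k => [|k]; rewrite ?muln0 // expnM leq_exp2r.
Qed.

(* Exponents [a] such that the respective numbers are at most [X ^ a], where [X] is
   the sum of 2, the length and the largest entry of the input. *)
Definition H_deg (K : nat) : nat := 8 * K * K * K.+1 + 1 + 2 * K.+1.
Definition M_deg (K : nat) : nat := 8 + 1 + H_deg K * (2 * K).
Definition V_deg (K : nat) : nat := 1 + M_deg K.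
Definition F0_deg (K : nat) : nat := K + 2 * K + 1.
Definition word_deg (K Q0 : nat) : nat :=
  (8 + 1 + H_deg K * K + F0_deg K + (K + (V_deg K + 1)) + 1) +
  (V_deg K + 1 + 1) * K + Q0 + 10.

(** With Y = X ^ [word_deg], the first summand provides Y^D <= B for the program itself, the second
    one (Y^2)^d <= B for the calls. *)
Definition pk_deg (K Q0 : nat) (KP : cmd) (d : nat) : nat :=
  word_deg K Q0 * cdeg (pk_prog K Q0 KP) + word_deg K Q0 * 2 * d.

(** The ratio of the ends of the grid is H^(2K), so 2 K (log2 H + 1) doublings suffice, each taking
    at most 2 N steps. *)
Definition grid_steps (K : nat) (f0 : nat -> nat) (n : nat) : nat :=
  2 * nN f0 * (2 * K * (trunc_log 2 (nH K n f0)).+1).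

Lemma pk_prog_correct (K Q0 n p q B d T : nat) (KP : cmd) (I : pknapsack K n)
    (Good : ('I_n -> nat) -> {set 'I_n} -> Prop) :
  0 < K -> word_bound (pk_deg K Q0 KP d) (pk_input I p q) <= B ->
  let f0 := pk_cells I p q in
  (forall pr, word_bound d (KP_input Q0 f0 pr) <= B ->
    exists t x, [/\ runs B KP (KP_input Q0 f0 pr) t (encode_solution x),
      t <= T & Good pr x]) ->
  exists t S num den v L, [/\ [/\
      runs B (pk_prog K Q0 KP) (pk_input I p q) t
        (flatten [seq encode_solution x | x : {set 'I_n} <- S]),
      t <= pk_cost K Q0 * (L.+1 ^ K * (n + T + 1)) &
      L <= grid_steps K f0 n],
    [/\ forall k, k < K -> min_ratio n f0 num den (K * n) k,
        forall i, i <= L -> v i = vgrid (nN f0) i &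
        nM K n f0 <= vgrid (nN f0) L],
    forall x, x \in S ->
      exists i, Good (fun e : 'I_n => nprofit K n f0 num den v L i e) x &
    forall i, i < L.+1 ^ K -> exists2 x, x \in S &
      Good (fun e : 'I_n => nprofit K n f0 num den v L i e) x].
Proof.
move=> K0 hB f0 KPs.
set X := 2 + size (pk_input I p q) + \max_(v <- pk_input I p q) v.
have X2 : 2 <= X by rewrite /X -addnA leq_addr.
have X0 : 0 < X by exact: ltnW.
have fX i : f0 i + 2 <= X by exact: cells_lt.
have fX1 i : f0 i <= X ^ 1 by rewrite expn1; apply: leq_trans (fX i); exact: leq_addr.
have sX : size (pk_input I p q) + 2 <= X by rewrite addnC /X leq_addr.
rewrite size_pk_input in sX.
have EX : nE f0 <= X ^ 1.
  rewrite /nE expn1; apply: leq_trans (fX 2); apply: leq_add => //; exact: leq_div.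
have SX : nS K n f0 <= X ^ 2.
  apply: (@leq_trans (\sum_(i < K.+1 * n) X)).
    by apply: leq_sum => i _; have := fX1 (5 + n + i); rewrite expn1.
  by rewrite sum_nat_const card_ord (leq_mulX (a := 1) (b := 1)) ?expn1 //; nia.
have HX : nH K n f0 <= X ^ H_deg K.
  apply: leq_mulX (leq_powX _ SX); apply: leq_mulX EX; exact: leq_expX.
have NX : nN f0 <= X ^ (8 + 1) by apply: leq_mulX EX; exact: leq_expX.
have MX : nM K n f0 <= X ^ M_deg K by apply: leq_mulX NX (leq_powX _ HX).
have ZX : nZ K n f0 <= X ^ (8 + 1 + H_deg K * K) by apply: leq_mulX NX (leq_powX _ HX).
have N0 : 0 < nN f0 by rewrite /nN /nE addn1.
have hs : nM K n f0 <= 2 ^ (2 * K * (trunc_log 2 (nH K n f0)).+1) * nN f0.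
  rewrite /nM mulnC leq_mul2r; apply/orP; right.
  rewrite [X in 2 ^ X]mulnC (expnM 2) leq_exp2r ?muln_gt0 //.
  exact/ltnW/trunc_log_ltn.
have [L [ltL geL hL]] := vgrid_length N0 hs.
(* The last grid value may exceed [nM], but it is at most twice its predecessor; hence the extra 1
   in [V_deg]. *)
have VX i : i <= L -> vgrid (nN f0) i <= X ^ V_deg K.
  case: i => [_|i hi].
    apply: leq_trans NX _; rewrite leq_pexp2l // /V_deg /M_deg; lia.
  have {}hi := ltnW (ltL _ hi); rewrite /= /V_deg expnD expn1.
  have := leq_div (vgrid (nN f0) i) (nN f0); have := leq_trans hi MX.
  by move: (X ^ M_deg K) => z; nia.
have LX : L.+1 <= X ^ (V_deg K + 1 + 1).
  rewrite -addn1; apply: (leq_addX (b := 1)) => //.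
  by apply: leq_trans (VX L _); rewrite ?vgrid_gei.
have GX : L.+1 ^ K <= X ^ ((V_deg K + 1 + 1) * K) by apply: leq_powX.
pose Y := X ^ word_deg K Q0.
have ltY a z : a < word_deg K Q0 -> z <= X ^ a -> z < Y.
  by move=> ha hz; apply: leq_ltn_trans hz _; rewrite ltn_exp2l.
have fY i : f0 i < Y by apply: ltY (fX1 i); rewrite /word_deg; lia.
have Y1 : 1 < Y by apply: (ltY 1); rewrite ?expn1 // /word_deg; lia.
have n2X : 4 + 2 * n <= X ^ 1 by rewrite expn1; nia.
have := @run_pk K Q0 n f0 B Y (cdeg (pk_prog K Q0 KP)) L KP d T Good
  (init_memory (pk_input I p q)) K0 erefl Y1 _ _ (leqnn _) ltL geL KPs fY.
case.
- by apply: leq_trans hB; rewrite /word_bound -/X /Y -expnM leq_pexp2l // leq_addr.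
- apply: leq_trans hB; rewrite /word_bound -/X /Y -(expnM X) -(expnM X) leq_pexp2l //.
  exact: leq_addl.
- by apply: ltY SX; rewrite /word_deg; lia.
- by apply: (ltY 1); [rewrite /word_deg; lia|rewrite expn1; nia].
- by move=> i /VX; apply: ltY; rewrite /word_deg; lia.
- by apply: ltnW; apply: ltY LX; rewrite /word_deg; lia.
- by apply: ltY n2X; rewrite /word_deg; lia.
- by apply: (ltY (Q0 + 1)); [rewrite /word_deg; lia|apply: leq_mulX EX; exact: leq_expX].
- move=> num den v hmin hv i e en.
  apply: (ltY (8 + 1 + H_deg K * K + F0_deg K + (K + (V_deg K + 1)) + 1)).
    by rewrite /word_deg; lia.
  apply: leq_addX => //.
    apply: leq_mulX => //.
    have hb e' := cells_base I p q e'; have hsl k e' := cells_slope I p q k e'.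
    have hle k := @sum_slope_le _ _ I p q k.
    apply: leq_trans (nF0_le hb hsl hmin hle e) _.
    apply: leq_mulX; last exact: fX1.
    by apply: leq_mulX (leq_powX _ SX); exact: leq_expX.
  apply: (@leq_trans (\sum_(k < K) X ^ (V_deg K + 1))).
    apply: leq_sum => k _; apply: leq_mulX; last exact: fX1.
    by rewrite hv ?VX // -ltnS ltn_pmod.
  by rewrite sum_nat_const card_ord; apply: leq_mulX => //; exact: leq_expX.
- by apply: ltY GX; rewrite /word_deg; lia.
- by apply: ltY (leq_mulX GX (_ : n <= X ^ 1)); [rewrite /word_deg; lia|exact: fX1 3].
- by [].
- by move=> a i /negbTE na; rewrite /init_memory /set_array na.
move=> t [m [hex ht [num [den [v [S [h1 h2 h3 h4 h5]]]]]]].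
exists t, S, num, den, v, L; split=> //; split=> //.
by exists m.
Qed.

End WordBound.

(** * Binary logarithms and the size of the instance *)

Section Log2.
Variable R : realType.
Implicit Types x y : R.

Lemma ln2_gt0 : 0 < ln 2 :> R.
Proof. by rewrite ln_gt0 // ltr1n. Qed.

Lemma log2M x y : 0 < x -> 0 < y -> log2 (x * y) = log2 x + log2 y.
Proof. by move=> x0 y0; rewrite /log2 lnM ?posrE // mulrDl. Qed.

Lemma log2X x k : 0 < x -> log2 (x ^+ k) = k%:R * log2 x.
Proof. by move=> x0; rewrite /log2 lnXn // -[X in X / _]mulr_natl mulrA. Qed.

Lemma log2_le x y : 0 < x -> x <= y -> log2 x <= log2 y.
Proof.
move=> x0 xy; rewrite /log2 ler_pM2r ?invr_gt0 ?ln2_gt0 // ler_ln ?posrE //.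
exact: lt_le_trans xy.
Qed.

Lemma log2_2 : log2 2 = 1 :> R.
Proof. by rewrite /log2 divff // gt_eqF // ln2_gt0. Qed.

Lemma log2_ge0 x : 1 <= x -> 0 <= log2 x.
Proof. by move=> x1; apply: divr_ge0; [exact: ln_ge0|exact/ltW/ln2_gt0]. Qed.

Lemma log2_le_mul2 x : 1 <= x -> log2 x <= 2 * x.
Proof.
move=> x1; have x0 : 0 < x by lra.
have h2 : 2^-1 <= ln 2 :> R.
  have := @le_ln1Dx R (- 2^-1); rewrite (_ : 1 + - 2^-1 = 2^-1); last by lra.
  by rewrite lnV ?posrE //; lra.
have hx : ln x <= x 
  by have := @le_ln1Dx R (x - 1); rewrite (_ : 1 + (x - 1) = x); lra.
rewrite /log2 ler_pdivrMr ?ln2_gt0 //; apply: le_trans hx _; nra.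
Qed.

Lemma trunc_log_le_log2 (m : nat) : (0 < m)%N -> (trunc_log 2 m)%:R <= log2 m%:R :> R.
Proof.
move=> m0; have /(log2_le) : 0 < 2 ^+ trunc_log 2 m :> R by rewrite exprn_gt0.
move=> /(_ m%:R); rewrite log2X // log2_2 mulr1; apply.
by rewrite -natrX ler_nat trunc_logP.
Qed.

Lemma log2_nat_ge0 (m : nat) : (0 < m)%N -> 0 <= log2 m%:R :> R.
Proof. by move=> m0; rewrite log2_ge0 // ler1n. Qed.

End Log2.

Lemma leq_size_bit_size s : (size s <= bit_size s)%N.
Proof. by rewrite /bit_size -sum1_size; apply: leq_sum. Qed.

Lemma ltn_exp_bit_size (s : seq nat) v : v \in s -> (v < 2 ^ bit_size s)%N.
Proof.
move=> vs; apply: leq_trans (trunc_log_ltn v (isT : 1 < 2)%N) _.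
by rewrite leq_exp2l // /bit_size (big_rem v) //= leq_addr.
Qed.

Lemma n_gt0 (K n : nat) (I : pknapsack K n) : (0 < K)%N -> (0 < n)%N.
Proof.
by move=> K0; have [[e en] _] := slope_neq0 I (Ordinal K0); exact: leq_ltn_trans en.
Qed.

Lemma max_component_gt0 (K n : nat) (I : pknapsack K n) :
  (0 < K)%N -> (0 < max_component I)%N.
Proof.
move=> K0; have [e] := slope_neq0 I (Ordinal K0); rewrite -lt0n => /leq_trans; apply.
apply: leq_trans (leq_maxr _ _).
apply: leq_trans (leq_bigmax (F := fun k => \max_e slope I k e)%N (Ordinal K0)).
exact: leq_bigmax.
Qed.

(** Bounds log2 C by the instance size, as needed for polynomial running time. *)
Lemma max_component_le_exp (K n : nat) (I : pknapsack K n) :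
  (max_component I <= 2 ^ bit_size (pk_encode I))%N.
Proof.
have sz : size (pk_encode I) = (2 + (K + 2) * n)%N.
  by have := size_pk_input I 0 0; rewrite /= => -[->]; lia.
have mem_cell i : (i < (K + 2) * n)%N -> pk_cells I 0 0 (5 + i) \in pk_encode I.
  move=> hi; have -> : pk_cells I 0 0 (5 + i) = nth 0%N (pk_encode I) (2 + i) by [].
  by apply: mem_nth; rewrite sz ltn_add2l.
rewrite geq_max; apply/andP; split.
  apply/bigmax_leqP => e _; apply/ltnW/ltn_exp_bit_size.
  by rewrite (cells_base I 0 0) /nbase -addnA; apply: mem_cell; have := ltn_ord e; nia.
apply/bigmax_leqP => k _; apply/bigmax_leqP => e _; apply/ltnW/ltn_exp_bit_size.
rewrite (cells_slope I 0 0) /nslope -addnA; apply: mem_cell.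
by have := ltn_ord e; have := ltn_ord k; nia.
Qed.

(** * The running time in terms of E, n and C *)

Section Time.
Variables (R : realType) (K Q0 : nat) (KP : cmd) (d : nat) (c0 eps0 : R).
Hypotheses (K_gt0 : (0 < K)%N) (Q0_ge8 : (8 <= Q0)%N) (Q0_eps : Q0%:R^-1 <= eps0).
Hypothesis KP_spec :
  forall (n W : nat) (w profit : 'I_n -> nat) (p q B : nat),
    let eps : R := p%:R / q%:R in
    let input := [:: p, q & encode W w [:: profit]] in
    (0 < n)%N -> (0 < p)%N -> (0 < q)%N -> (word_bound d input <= B)%N ->
    exists (t : nat) (x : {set 'I_n}),
      [/\ runs B KP input t (encode_solution x),
          feasible W w x,
          (forall x', feasible W w x' ->
             (1 - eps) * (\sum_(e in x') profit e)%:R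
               <= (\sum_(e in x) profit e)%:R)
        & eps <= eps0 -> t%:R <= c0 * kp_time n eps].

(** The 33 is 2 * 8 * 2, collected from [grid_steps] and [nN], plus 1 for the successor. The bracket
    gathers the coefficients of log2 H + 1 after S is replaced by (K + 1) n C. *)
Definition grid_const : R :=
  33 * K%:R * (log2 (8 * K * K * K.+1)%:R + K.+1%:R * log2 K.+1%:R + K.+1%:R + 1).

Definition kp_const : R := 2 + `|c0| * Q0%:R ^+ 3 * (log2 Q0%:R + 1) ^+ 2.

Lemma grid_steps_le (n p q : nat) (I : pknapsack K n) :
  (grid_steps K (pk_cells I p q) n).+1%:R <=
    grid_const * ((nE (pk_cells I p q))%:R *
      (1 + log2 (nE (pk_cells I p q))%:R + log2 (n * max_component I)%N%:R)).
Proof.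
set E := nE (pk_cells I p q); have n0 := n_gt0 I K_gt0; have C0 := max_component_gt0 I K_gt0.
have E0 : (0 < E)%N by rewrite /E /nE addn1.
pose tl := trunc_log 2 (nH K n (pk_cells I p q)).
have S_le := nS_le_max I p q.
pose S' := (K.+1 * (n * max_component I))%N.
have S'0 : (0 < S')%N by rewrite !muln_gt0 n0 C0.
pose c := (8 * K * K * K.+1)%N; have cgt0 : (0 < c)%N by rewrite !muln_gt0 K_gt0.
have lc := log2_nat_ge0 R cgt0; have lE := log2_nat_ge0 R E0.
have lK := log2_nat_ge0 R (ltn0Sn K).
have lC : 0 <= log2 (n * max_component I)%N%:R :> R by rewrite log2_nat_ge0 // muln_gt0 n0.
have tl_le : tl%:R <= log2 c%:R + log2 E%:R +
    K.+1%:R * (log2 K.+1%:R + log2 (n * max_component I)%N%:R) :> R.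
  have [H0|H0] := posnP (nH K n (pk_cells I p q)).
    by rewrite /tl H0 trunc_log0 !addr_ge0 // mulr_ge0 // addr_ge0.
  apply: le_trans (trunc_log_le_log2 R H0) _.
  rewrite -!log2M ?ltr0n ?muln_gt0 ?n0 ?K_gt0 //.
  rewrite -log2X ?ltr0n // -?log2M ?exprn_gt0 ?mulr_gt0 ?ltr0n ?muln_gt0 ?n0 ?K_gt0 //.
  apply: log2_le; first by rewrite ltr0n.
  rewrite -!natrM -natrX -natrM ler_nat /nH -/E -/c leq_mul2l; apply/orP; right.
  by rewrite leq_exp2r // mulnA.
have K1 : 1 <= K%:R :> R by rewrite ler1n.
have E1 : 1 <= E%:R :> R by rewrite ler1n.
have -> : (grid_steps K (pk_cells I p q) n).+1%:R = 32 * K%:R * E%:R * (tl%:R + 1) + 1 :> R.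
  rewrite /grid_steps /nN -/E -/tl -natr1 !natrM -[(tl).+1%:R]natr1; ring.
have tl0 : 0 <= tl%:R :> R by [].
apply: (@le_trans _ _ (33 * K%:R * E%:R * (tl%:R + 1))).
  have : 1 <= K%:R * E%:R * (tl%:R + 1) :> R by rewrite mulr_ege1 ?(mulr_ege1 K1 E1) // lerDr.
  lra.
rewrite /grid_const -/c -!mulrA ler_pM2l // ler_pM2l ?(lt_le_trans ltr01) //.
rewrite [leRHS]mulrCA ler_pM2l ?(lt_le_trans ltr01) //.
have K1' : 1 <= K.+1%:R :> R by rewrite ler1n.
move: (log2 c%:R) (log2 E%:R) (log2 K.+1%:R) (log2 (n * max_component I)%N%:R) lc lE lK lC tl_le.
move=> a e k m a0 e0 k0 m0 h.
apply: (@le_trans _ _ (a + e + K.+1%:R * (k + m) + 1)); first by lra.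
have : 0 <= a * (e + m) by rewrite mulr_ge0 ?addr_ge0.
have : 0 <= K.+1%:R * k * (e + m) by rewrite !mulr_ge0 ?addr_ge0.
have : 0 <= K.+1%:R * e by rewrite mulr_ge0.
lra.
Qed.

Lemma kp_time_ge0 (n r : nat) : (0 < n)%N -> (0 < r)%N -> 0 <= kp_time n (r%:R^-1 : R).
Proof.
move=> n0 r0; rewrite /kp_time invrK; have ln := log2_nat_ge0 R n0.
have lr := log2_nat_ge0 R r0.
have r1 : 0 <= r%:R :> R by [].
apply: addr_ge0; apply: mulr_ge0 => //; first by rewrite le_min ln lr.
  by apply: mulr_ge0 => //; exact: exprn_ge0.
by rewrite le_min ler0n /=; exact: mulr_ge0.
Qed.

(** Both minima in [kp_time] are bounded by their second arguments, which gives n l + r^3 l^2 for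
    accuracy 1 / r. The 1 in 1 + log2 E keeps the estimate valid at E = 1, where the logarithm
    vanishes. *)
Lemma kp_time_le (n E : nat) : (0 < n)%N -> (0 < E)%N ->
  n%:R + `|c0| * kp_time n ((Q0 * E)%N%:R^-1 : R) + 1 <=
  kp_const * (n%:R * (1 + log2 E%:R) + E%:R ^+ 3 * (1 + log2 E%:R) ^+ 2).
Proof.
move=> n0 E0; have Q00 : (0 < Q0)%N by exact: leq_trans Q0_ge8.
rewrite /kp_time invrK natrM log2M ?ltr0n //.
have Q1 : 1 <= Q0%:R :> R by rewrite ler1n.
have E1 : 1 <= E%:R :> R by rewrite ler1n.
have n1 : 1 <= n%:R :> R by rewrite ler1n.
have lQ := log2_nat_ge0 R Q00; have lE := log2_nat_ge0 R E0.
have ln := log2_nat_ge0 R n0.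
rewrite /kp_const; move: (log2 Q0%:R) (log2 E%:R) (log2 n%:R) lQ lE ln => a e k a0 e0 k0.
set la := 1 + e; set cq := a + 1.
have la1 : 1 <= la by rewrite /la; lra.
have cq1 : 1 <= cq by rewrite /cq; lra.
have le_l : a + e <= cq * la by rewrite /cq /la; nra.
have l0 : 0 <= a + e by rewrite addr_ge0.
pose QE : R := Q0%:R * E%:R; have QE0 : 0 <= QE by rewrite /QE mulr_ge0.
have b1 : n%:R * Num.min k (a + e) <= n%:R * (cq * la).
  by rewrite ler_wpM2l // ge_min le_l orbT.
have b2 : QE ^+ 2 * (a + e) * Num.min n%:R (QE * (a + e)) <=
    Q0%:R ^+ 3 * cq ^+ 2 * (E%:R ^+ 3 * la ^+ 2).
  have -> : Q0%:R ^+ 3 * cq ^+ 2 * (E%:R ^+ 3 * la ^+ 2) =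
     (QE ^+ 2 * (cq * la)) * (QE * (cq * la)) by rewrite /QE; ring.
  apply: ler_pM.
  - by rewrite mulr_ge0 ?exprn_ge0.
  - by rewrite le_min ler0n mulr_ge0.
  - by rewrite ler_wpM2l ?exprn_ge0.
  - by rewrite ge_min; apply/orP; right; rewrite ler_wpM2l.
rewrite -/QE; have c00 : 0 <= `|c0| by [].
have q3 : 1 <= Q0%:R ^+ 3 :> R by rewrite exprn_ege1.
have b3 : n%:R * (cq * la) <= Q0%:R ^+ 3 * cq ^+ 2 * (n%:R * la).
  have -> : n%:R * (cq * la) = 1 * cq * (n%:R * la) by ring.
  rewrite ler_wpM2r ?mulr_ge0 //; first by lra.
  by apply: ler_pM => //; [lra|rewrite expr2 ler_peMl //; lra].
have b4 : n%:R + 1 <= 2 * (n%:R * la + E%:R ^+ 3 * la ^+ 2).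
  have : n%:R <= n%:R * la by rewrite ler_peMr.
  have : 0 <= E%:R ^+ 3 * la ^+ 2 by rewrite mulr_ge0 ?exprn_ge0 //; lra.
  lra.
have b5 : `|c0| * (n%:R * Num.min k (a + e) +
    QE ^+ 2 * (a + e) * Num.min n%:R (QE * (a + e))) <=
    `|c0| * (Q0%:R ^+ 3 * cq ^+ 2 * (n%:R * la) +
             Q0%:R ^+ 3 * cq ^+ 2 * (E%:R ^+ 3 * la ^+ 2)).
  by rewrite ler_wpM2l // lerD // (le_trans b1).
rewrite addrAC; apply: le_trans (lerD b4 b5) _.
by rewrite le_eqVlt; apply/orP; left; apply/eqP; ring.
Qed.

(** Rounding q / p upwards guarantees the accuracy, and the lower bound eps / 2 on p / q limits what
    this costs. *)
Lemma accuracy_bounds (eps : R) (p q : nat) : accuracy_code eps p q ->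
  (q %/ p + 1)%N%:R^-1 <= eps /\ (q %/ p + 1)%N%:R <= 2 * eps^-1 + 1.
Proof.
move=> [p0 q0 /andP[h1 h2]].
have p0' : 0 < p%:R :> R by rewrite ltr0n.
have q0' : 0 < q%:R :> R by rewrite ltr0n.
have e0 : 0 < eps by apply: lt_le_trans h2; rewrite divr_gt0.
split.
  apply: le_trans h2; rewrite -[leRHS]invrK lef_pV2 ?posrE ?invr_gt0 ?divr_gt0 ?ltr0n ?addn1 //.
  by rewrite invf_div ler_pdivrMr // -natrM ler_nat ltnW // ltn_ceil.
rewrite natrD lerD2r; apply: (@le_trans _ _ (q%:R / p%:R)).
  by rewrite ler_pdivlMr // -natrM ler_nat leq_trunc_div.
have : (p%:R / q%:R)^-1 <= (eps / 2)^-1 by rewrite lef_pV2 ?posrE ?divr_gt0.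
by rewrite !invf_div.
Qed.

Definition time_const : R := (pk_cost K Q0)%:R * grid_const ^+ K * kp_const.

Lemma pk_prog_computes (n p q B : nat) (I : pknapsack K n) (eps : R) :
  accuracy_code eps p q ->
  (word_bound (pk_deg K Q0 KP d) [:: p, q & pk_encode I] <= B)%N ->
  let E := (q %/ p + 1)%N in
  exists (t : nat) (S : seq {set 'I_n}),
    [/\ runs B (pk_prog K Q0 KP) [:: p, q & pk_encode I] t
          (flatten [seq encode_solution x | x <- S]),
        approximation_set I (1 + eps) S
      & t%:R <= time_const *
         ((E%:R * (1 + log2 E%:R + log2 (n * max_component I)%N%:R)) ^+ K *
          (n%:R * (1 + log2 E%:R) + E%:R ^+ 3 * (1 + log2 E%:R) ^+ 2))].
Proof.
move=> hacc hB E; have [hE1 hE2] := accuracy_bounds hacc.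
have n0 := n_gt0 I K_gt0; have E0 : (0 < E)%N by rewrite /E addn1.
have Q00 : (0 < Q0)%N by exact: leq_trans Q0_ge8.
pose f0 := pk_cells I p q; pose r := (Q0 * E)%N.
have EE : nE f0 = E by [].
have r0 : (0 < r)%N by rewrite muln_gt0 Q00.
pose kpt : R := `|c0| * kp_time n (r%:R^-1 : R).
(* Steps are counted by natural numbers, so nothing is lost by truncation. The absolute value in
   [kpt] makes the bound nonnegative, since no sign of [c0] is given. *)
pose T := Num.truncn kpt.
have kpt0 : 0 <= kpt by rewrite mulr_ge0 // kp_time_ge0.
have KPs (pr : 'I_n -> nat) : (word_bound d (KP_input Q0 f0 pr) <= B)%N ->
    exists t x, [/\ runs B KP (KP_input Q0 f0 pr) t (encode_solution x),
      (t <= T)%N & good_solution R f0 r pr x].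
  move=> hw; have := KP_spec (n := n) (W := f0 4%N) (w := fun e : 'I_n => f0 (5 + e)%N)
    (profit := pr) (p := 1) (q := r) n0 isT r0 hw.
  case=> t [x [h1 h2 h3 h4]]; exists t, x; split=> //.
    (* The accuracy 1 / ([Q0] E) is at most [eps0] whatever eps is, so the asymptotic bound of the
       knapsack program applies to every call. *)
    have h5 : t%:R <= c0 * kp_time n (1%:R / r%:R : R).
      apply: h4; rewrite div1r; apply: le_trans Q0_eps.
      by rewrite lef_pV2 ?posrE ?ltr0n // ler_nat leq_pmulr.
    rewrite div1r in h5.
    rewrite /T truncn_ge_nat //; apply: le_trans h5 _.
    by rewrite ler_wpM2r ?kp_time_ge0 // ler_norm.
  by split=> // x' hx'; have := h3 x' hx'; rewrite div1r.
have [t [S [num [den [v [L [[h1 h2 h3] [h4 h5 h6] h7 h8]]]]]]] :=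
  pk_prog_correct K_gt0 hB KPs.
exists t, S; split=> //.
  apply: (@approximation_of_grid R K n Q0 L I f0 num den v) => //.
  - exact: cells_base.
  - exact: cells_slope.
  - exact: cells_weight.
  - exact: sum_base_le.
  - exact: sum_slope_le.
apply: (@le_trans _ _ (pk_cost K Q0 * (L.+1 ^ K * (n + T + 1)))%N%:R).
  by rewrite ler_nat.
set X := E%:R * _; set W := n%:R * _ + _.
have gl : (grid_steps K f0 n).+1%:R <= grid_const * X := grid_steps_le p q I.
rewrite !natrM natrX /time_const -2!mulrA ler_wpM2l //.
rewrite [leRHS](_ : _ = (grid_const * X) ^+ K * (kp_const * W)); last first.
  by rewrite (exprMn _ grid_const X) -!mulrA; congr (_ * _); rewrite mulrCA.
apply: ler_pM; rewrite ?exprn_ge0 //.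
  apply: lerXn2r; rewrite ?nnegrE //; last first.
    by apply: le_trans gl; rewrite ler_nat ltnS.
  exact: le_trans gl.
apply: le_trans (kp_time_le n0 E0).
by rewrite natrD natrD lerD2r lerD2l truncn_le.
Qed.

End Time.

(** For eps <= 1/4 one has E <= 3 / eps and 1 + log2 E <= 4 log2 (1/eps); away from 1 the logarithm
    absorbs the additive constants. Thus 12 = 3 * 4 and 432 = 27 * 16. *)
Lemma pk_time_bound (R : realType) (K n E : nat) (I : pknapsack K n) (eps : R) :
  (0 < K)%N -> (0 < E)%N -> 0 < eps <= 4^-1 -> E%:R <= 2 * eps^-1 + 1 ->
  (E%:R * (1 + log2 E%:R + log2 (n * max_component I)%N%:R)) ^+ K *
    (n%:R * (1 + log2 E%:R) + E%:R ^+ 3 * (1 + log2 E%:R) ^+ 2) <=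
  12 ^+ K * 432 * pk_time I eps.
Proof.
move=> K0 E0 /andP[e0 e4] hE.
have n0 := n_gt0 I K0; have C0 := max_component_gt0 I K0.
have x4 : 4 <= eps^-1 by rewrite -[4]invrK lef_pV2 ?posrE ?invr_gt0.
have -> : pk_time I eps = (n%:R * log2 eps^-1 + eps^-1 ^+ 3 * log2 eps^-1 ^+ 2) *
  (eps^-1 * log2 eps^-1 + eps^-1 * log2 (n * max_component I)%N%:R) ^+ K by [].
have m0 : 0 <= log2 (n * max_component I)%N%:R :> R by rewrite log2_nat_ge0 // muln_gt0 n0.
have E1 : 1 <= E%:R :> R by rewrite ler1n.
have lE0 := log2_nat_ge0 R E0.
have n1 : 1 <= n%:R :> R by rewrite ler1n.
have x0 : 0 < eps^-1 by rewrite invr_gt0.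
have l1 : 1 <= log2 eps^-1 by rewrite -(log2_2 R); apply: log2_le => //; lra.
have E3 : E%:R <= 3 * eps^-1 by lra.
have la : 1 + log2 E%:R <= 4 * log2 eps^-1.
  have : log2 E%:R <= 2 + log2 eps^-1.
    have -> : 2 = log2 (2 ^+ 2) :> R by rewrite log2X // log2_2 mulr1.
    rewrite -log2M //; first by apply: log2_le; [rewrite ltr0n|rewrite expr2; lra].
    by rewrite exprn_gt0.
  lra.
have la0 : 0 <= 1 + log2 E%:R :> R by rewrite addr_ge0.
move: (eps^-1) x0 x4 l1 E3 la hE => x x0 x4 l1 E3 la _.
move: (log2 x) (log2 (n * max_component I)%N%:R) (1 + log2 E%:R) l1 m0 la la0 => l m k l1 m0 la la0.
have l0 : 0 <= l by lra.
have b1 : E%:R * (k + m) <= 12 * (x * l + x * m).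
  apply: (@le_trans _ _ (3 * x * (4 * l + m))).
    by apply: ler_pM => //; lra.
  have : 0 <= x * m by rewrite mulr_ge0 // ltW.
  lra.
have k2 : k ^+ 2 <= 16 * l ^+ 2.
  rewrite (_ : 16 * l ^+ 2 = (4 * l) ^+ 2); last by ring.
  by rewrite lerXn2r ?nnegrE //; lra.
have E33 : E%:R ^+ 3 <= 27 * x ^+ 3.
  rewrite (_ : 27 * x ^+ 3 = (3 * x) ^+ 3); last by ring.
  by rewrite lerXn2r ?nnegrE //; lra.
have b2 : n%:R * k + E%:R ^+ 3 * k ^+ 2 <= 432 * (n%:R * l + x ^+ 3 * l ^+ 2).
  have h1 : n%:R * k <= 4 * (n%:R * l) by rewrite mulrCA ler_wpM2l.
  have h2 : E%:R ^+ 3 * k ^+ 2 <= (27 * x ^+ 3) * (16 * l ^+ 2).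
    by apply: ler_pM; rewrite ?exprn_ge0.
  have h3 : 0 <= n%:R * l by rewrite mulr_ge0.
  have -> : 432 * (n%:R * l + x ^+ 3 * l ^+ 2) = 432 * (n%:R * l) + 27 * x ^+ 3 * (16 * l ^+ 2).
    by ring.
  lra.
have s0 : 0 <= E%:R * (k + m) by rewrite mulr_ge0 // addr_ge0.
apply: (@le_trans _ _ ((12 * (x * l + x * m)) ^+ K * (432 * (n%:R * l + x ^+ 3 * l ^+ 2)))).
  apply: ler_pM => //; first exact: exprn_ge0.
    by rewrite addr_ge0 // mulr_ge0 // exprn_ge0.
  by rewrite lerXn2r ?nnegrE // (le_trans s0).
by rewrite exprMn -!mulrA; apply: ler_wpM2l; rewrite ?exprn_ge0 // mulrCA ler_wpM2l // mulrC.
Qed.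

(** Here eps may be large, so everything is compared with w, which is at least n and hence at least
    1: E <= 3 w, 1 + log2 E <= 7 w and log2 (n C) <= 3 w. Thus 30 = 3 * (7 + 3), and 1400 exceeds 7
    + 27 * 49. *)
Lemma fptas_time_bound (R : realType) (K n E : nat) (I : pknapsack K n) (eps : R) :
  (0 < K)%N -> (0 < E)%N -> 0 < eps -> E%:R <= 2 * eps^-1 + 1 ->
  (E%:R * (1 + log2 E%:R + log2 (n * max_component I)%N%:R)) ^+ K *
    (n%:R * (1 + log2 E%:R) + E%:R ^+ 3 * (1 + log2 E%:R) ^+ 2) <=
  30 ^+ K * 1400 * ((bit_size (pk_encode I))%:R + eps^-1) ^+ (2 * K + 5).
Proof.
move=> K0 E0 e0 hE; have n0 := n_gt0 I K0; have C0 := max_component_gt0 I K0.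
set b := bit_size _; set w := _ + eps^-1.
have x0 : 0 < eps^-1 by rewrite invr_gt0.
have n_b : (n <= b)%N.
  apply: leq_trans (leq_size_bit_size _); have := size_pk_input I 0 0.
  by rewrite /= => -[->]; nia.
have n1 : 1 <= n%:R :> R by rewrite ler1n.
have nw : n%:R <= w.
  by apply: (@le_trans _ _ b%:R); [rewrite ler_nat|rewrite /w lerDl ltW].
have w1 : 1 <= w by lra.
have bw : b%:R <= w by rewrite /w lerDl ltW.
have xw : eps^-1 <= w by rewrite /w lerDr.
have E1 : 1 <= E%:R :> R by rewrite ler1n.
have E3 : E%:R <= 3 * w by lra.
have k7 : 1 + log2 E%:R <= 7 * w by have := log2_le_mul2 E1; lra.
have k0 : 0 <= 1 + log2 E%:R :> R by rewrite addr_ge0 ?log2_nat_ge0.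
have m0 : 0 <= log2 (n * max_component I)%N%:R :> R by rewrite log2_nat_ge0 // muln_gt0 n0.
have m3 : log2 (n * max_component I)%N%:R <= 3 * w.
  rewrite natrM log2M ?ltr0n //; have := log2_le_mul2 n1.
  have : log2 (max_component I)%:R <= b%:R :> R.
    apply: le_trans (log2_le (y := (2 ^ b)%N%:R) _ _) _; rewrite ?ltr0n //.
      by rewrite ler_nat max_component_le_exp.
    by rewrite natrX log2X // log2_2 mulr1.
  lra.
move: (log2 (n * max_component I)%N%:R) (1 + log2 E%:R) k7 k0 m0 m3 => m k k7 k0 m0 m3.
have w0 : 0 <= w by lra.
apply: (@le_trans _ _ ((30 * w ^+ 2) ^+ K * (1400 * w ^+ 5))); last first.
  by rewrite exprMn -exprM exprD -!mulrA ler_wpM2l ?exprn_ge0 // mulrCA.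
have s0 : 0 <= E%:R * (k + m) by rewrite mulr_ge0 // addr_ge0.
apply: ler_pM; first exact: exprn_ge0.
- by rewrite addr_ge0 // mulr_ge0 // exprn_ge0.
- have b1 : E%:R * (k + m) <= 30 * w ^+ 2.
    rewrite (_ : 30 * w ^+ 2 = 3 * w * (7 * w + 3 * w)); last by ring.
    by apply: ler_pM => //; rewrite ?addr_ge0 ?lerD.
  by rewrite lerXn2r ?nnegrE // (le_trans s0).
have h1 : n%:R * k <= 7 * w ^+ 5.
  apply: (@le_trans _ _ (w * (7 * w))); first exact: ler_pM.
  rewrite (_ : w * (7 * w) = 7 * w ^+ 2); last by ring.
  by rewrite ler_wpM2l // ler_weXn2l.
have h2 : E%:R ^+ 3 * k ^+ 2 <= 1323 * w ^+ 5.
  rewrite (_ : 1323 * w ^+ 5 = (3 * w) ^+ 3 * (7 * w) ^+ 2); last by ring.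
  by apply: ler_pM; rewrite ?exprn_ge0 // lerXn2r ?nnegrE //; lra.
have : 0 <= w ^+ 5 by rewrite exprn_ge0.
lra.
Qed.

Theorem mainTheorem6 (R : realType) (K : nat) (hK : (1 <= K)%N)
    (hKP : kellerer_pferschy R) :
  exists P : cmd,
    fptas R K P /\
    exists (d : nat) (c eps0 : R), 0 < eps0 < 1 /\
      forall (n : nat) (I : pknapsack K n) (eps : R),
        0 < eps <= eps0 -> eps^-1 <= n%:R ->
        computes_within P d I eps (c * pk_time I eps).
Proof.
have [KP [d [c0 [eps0 [/andP[e0 e1] KP_spec]]]]] := hKP.
(* At least 8 for the error budget, and at least 1 / [eps0] so that all calls lie in the range of
   the assumed time bound. *)
pose Q0 := maxn 8 (Num.truncn eps0^-1).+1.
have Q8 : (8 <= Q0)%N by exact: leq_maxl.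
have Q00 : (0 < Q0)%N by exact: leq_trans Q8.
have Qe : Q0%:R^-1 <= eps0.
  rewrite -[leRHS]invrK lef_pV2 ?posrE ?invr_gt0 ?ltr0n //.
  apply: (@le_trans _ _ (Num.truncn eps0^-1).+1%:R); last by rewrite ler_nat leq_maxr.
  by apply/ltW; rewrite truncnS_gt.
have core := pk_prog_computes hK Q8 Qe KP_spec.
have c_ge0 : 0 <= time_const K Q0 c0.
  have lc : 0 <= log2 (8 * K * K * K.+1)%N%:R :> R.
    by rewrite log2_nat_ge0 // !muln_gt0 hK.
  have lK : 0 <= log2 K.+1%:R :> R by exact: log2_nat_ge0.
  have gc : 0 <= grid_const R K.
    apply: mulr_ge0; first exact: mulr_ge0.
    do 3!apply: addr_ge0 => //; exact: mulr_ge0.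
  have kc : 0 <= kp_const Q0 c0.
    by apply: addr_ge0 => //; rewrite mulr_ge0 ?sqr_ge0 // mulr_ge0 // exprn_ge0.
  by apply: mulr_ge0 => //; apply: mulr_ge0 => //; exact: exprn_ge0.
exists (pk_prog K Q0 KP); split.
  exists (pk_deg K Q0 KP d), (2 * K + 5)%N, (time_const K Q0 c0 * (30 ^+ K * 1400)).
  move=> n I eps eps_gt0 p q B hacc hB.
  have [t [S [h1 h2 h3]]] := core n p q B I eps hacc hB.
  exists t, S; split=> //; apply: le_trans h3 _.
  rewrite -[leRHS]mulrA ler_wpM2l //; apply: fptas_time_bound => //.
    by rewrite addn1.
  by case: (accuracy_bounds hacc).
exists (pk_deg K Q0 KP d), (time_const K Q0 c0 * (12 ^+ K * 432)), 4^-1.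
split; first by apply/andP; split; lra.
move=> n I eps heps _ p q B hacc hB.
have [t [S [h1 h2 h3]]] := core n p q B I eps hacc hB.
exists t, S; split=> //; apply: le_trans h3 _.
rewrite -[leRHS]mulrA ler_wpM2l //; apply: pk_time_bound => //.
  by rewrite addn1.
by case: (accuracy_bounds hacc).
Qed.
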